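(* For integers $n \ge 1$ and $t \ge 0$, let $f(n,t)$ be the maximum of $\operatorname{rg}(G,c)$ over all simple graphs $G$ with $|V(G)| = n$ and $|E(G)| = 2t$ and all colourings $c$ of $E(G)$ in which every colour class has size exactly $2$. Then for all $n \ge 3$ and $t \le n$: $f(n,t) = \infty$ if $t \le n-2$; $f(n,t) = n-1$ if $t = n-1$; and $f(n,t) = \lceil n/2 \rceil$ if $t = n$.
   Context: For an edge-coloured graph $(G,c)$, a cycle is rainbow if its edges have pairwise distinct colours. The rainbow girth $\operatorname{rg}(G,c)$ is the length of a shortest rainbow cycle in $(G,c)$, and $\operatorname{rg}(G,c) = \infty$ if $(G,c)$ has no rainbow cycle. A colour class is the set of edges receiving a given colour (so a colouring with all classes of size $2$ of a graph with $2t$ edges uses $t$ colours).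
   Formalization: In the cases t = n-1 and t = n it is also assumed that 2t ≤ C(n,2); this excludes only (n,t) = (3,2), (3,3), (4,4), where no simple graph on n vertices has 2t edges and so the maximum f(n,t) is undefined. *)

(* Defs.v *)
From HB Require Import structures.
From mathcomp Require Import all_boot.
From mathcomp Require Import boolp.

Set Implicit Arguments.
Unset Strict Implicit.
Unset Printing Implicit Defensive.

Record sgraph (V : finType) := SGraph {
  adj : rel V;
  adj_sym : symmetric adj;
  adj_irrefl : irreflexive adj }.

Definition edges (V : finType) (G : sgraph V) : {set {set V}} :=
  [set [set p.1; p.2] | p : V * V & adj G p.1 p.2].

(* A colouring is a total function on sets of vertices; only its values on
   [edges G] are ever used. *)
Definition colour_class (V : finType) (C : eqType) (G : sgraph V)
    (c : {set V} -> C) (a : C) : {set {set V}} :=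
  [set e in edges G | c e == a].

(* Only the colours that are actually used have a colour class. *)
Definition classes_of_size2 (V : finType) (C : eqType) (G : sgraph V)
    (c : {set V} -> C) : Prop :=
  forall e, e \in edges G -> #|colour_class G c (c e)| = 2.

(* The edges of the cycle [p] are the pairs {x, next p x} for x in p. *)
Definition rainbow_cycle (V : finType) (C : eqType) (G : sgraph V)
    (c : {set V} -> C) (p : seq V) : bool :=
  [&& 3 <= size p, ucycleb (adj G) p
    & uniq [seq c [set x; next p x] | x <- p]].

Definition has_rainbow_cycle (V : finType) (C : eqType) (G : sgraph V)
    (c : {set V} -> C) (k : nat) : bool :=
  [exists p : k.-tuple V, rainbow_cycle G c p].

(* Extended naturals: [None] stands for infinity. *)
Definition enat := option nat.

Definition enat_le (x y : enat) : bool :=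
  match x, y with
  | _, None => true
  | None, Some _ => false
  | Some a, Some b => a <= b
  end.

Definition rainbow_girth (V : finType) (C : eqType) (G : sgraph V)
    (c : {set V} -> C) : enat :=
  if pselect (exists k, has_rainbow_cycle G c k) is left h
  then Some (ex_minn h) else None.

Definition rainbow_girth_value (n t : nat) (v : enat) : Prop :=
  exists (V : finType) (C : eqType) (G : sgraph V) (c : {set V} -> C),
    [/\ #|V| = n, #|edges G| = 2 * t, classes_of_size2 G c
      & rainbow_girth G c = v].

(* [is_f n t v] is "f(n,t) = v", for f(n,t) the maximum of the rainbow girth.
   The maximum is a relation because it does not exist when 2t > 'C(n, 2). *)
Definition is_f (n t : nat) (v : enat) : Prop :=
  rainbow_girth_value n t v /\
  forall w, rainbow_girth_value n t w -> enat_le w v.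

Lemma rainbow_girth_value_bin2 (n t : nat) (v : enat) :
  rainbow_girth_value n t v -> 2 * t <= 'C(n, 2).
Proof.
case=> V [C] [G] [c] [<- <- _ _].
rewrite -card_draws; apply/subset_leq_card/subsetP => e.
case/imsetP=> -[x y]; rewrite inE /= => xy ->.
rewrite inE cards2; suff -> : x != y by [].
by apply/eqP => exy; rewrite exy adj_irrefl in xy.
Qed.

Lemma is_f_inj (n t : nat) (v w : enat) : is_f n t v -> is_f n t w -> v = w.
Proof.
case=> hv mv [hw mw]; move: (mv _ hw) (mw _ hv).
case: v w {hv mv hw mw} => [a|] [b|] //= h1 h2.
by congr Some; apply/eqP; rewrite eqn_leq h1 h2.
Qed.

(* Main.v *)
(** A graph with classes of size 2 is treated as a multigraph on m vertices in
    which each of m colours carries two edges, and the claim proved is that it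
    has a closed rainbow walk of length at most (m + p + 1) / 2, where p counts
    the colours whose two edges are parallel.  The case p = 0 is the bound for
    t = n.  For t = n - 1 some vertex v is not common to the two edges of any
    colour; keeping from every colour one edge that misses v, taken twice,
    gives m = p = n - 1.

    The claim goes by induction on m.  If some colour is parallel, its edge is
    grown to a maximal cluster of small rainbow diameter and contracted.  If
    p = 0 and m is odd, an edge of one colour is replaced by a copy of the
    other.  If p = 0 and m is even, delete a vertex set S from a counterexample;
    S kills the colours whose two edges touch S.  Bundling in pairs the colours
    that lose one edge shows that S kills more than |S| colours if it touches at
    most 3|S| edges, hence the graph is 4-regular.  Any S kills at least
    |S| - 1 colours, because a graph with n vertices and n + 2 edges has a
    circuit with at most half of the edges.

    If every vertex is the common vertex of the two edges of some colour, take a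
    largest S that touches at most 3|S| + 1 edges and kills at most |S| colours:
    the |S| + 1 colours with one edge touching S then yield a circuit on at most
    m / 2 vertices.  Otherwise a largest S that touches at most 3|S| + 1 edges
    and kills fewer than |S| colours must be a single vertex v, and contracting
    the closed neighbourhood of v creates no parallel colour.

    The extremal examples assign two out-neighbours to each vertex of a set D
    and colour an arc by its tail: every vertex of a rainbow cycle is then a
    tail, so it lies in D and has an out-neighbour on the cycle. *)

Require Import Defs.
From mathcomp Require Import all_boot.
From mathcomp Require Import boolp zify.

Set Implicit Arguments.
Unset Strict Implicit.
Unset Printing Implicit Defensive.

Lemma ex_subset_card (A : finType) (B : {set A}) k :
  k <= #|B| -> exists2 B' : {set A}, B' \subset B & #|B'| = k.
Proof.
case/card_geqP => s [us <- sB]; exists [set x in s].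
  by apply/subsetP => x; rewrite inE; apply: sB.
by rewrite cardsE; apply/card_uniqP.
Qed.

Lemma subset_card_eq (A : finType) (B B' : {set A}) :
  B \subset B' -> #|B'| <= #|B| -> B = B'.
Proof. by move=> sub le; apply/eqP; rewrite eqEcard sub. Qed.

Lemma set2_eq (A : finType) (B : {set A}) x y :
  #|B| <= 2 -> x \in B -> y \in B -> x != y -> B = [set x; y].
Proof.
move=> B2 xB yB xy; apply/esym/subset_card_eq; last by rewrite cards2 xy.
by rewrite subUset !sub1set xB.
Qed.

Lemma card_setId_predC (A : finType) (B : {set A}) (P : pred A) :
  #|[set x in B | P x]| + #|[set x in B | ~~ P x]| = #|B|.
Proof.
rewrite -(cardsID [set x | P x] B); congr (_ + _); apply: eq_card => x; rewrite !inE //.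
by rewrite andbC.
Qed.

Lemma next_map_uniq (A B : eqType) (f : A -> B) (l : seq A) x :
  uniq (map f l) -> x \in l -> next (map f l) (f x) = f (next l x).
Proof.
move=> ufl xl; have [i l' el] := rot_to xl.
rewrite -(next_rot i ufl) -(next_rot i (map_uniq ufl)) -map_rot el.
by case: l' {el} => [|y l'] /=; rewrite !eqxx.
Qed.

(** * Rainbow walks and circuits *)

(* A multigraph on [T] in which every colour of [C] carries two edges is a map
   [E] sending the edge [(c, b)], the [b]-th edge of colour [c], to its ends. *)

Section Walks.
Variables T C : finType.
Implicit Types (E : C * bool -> T * T) (K D : {set C}) (x y z : T).

(* An edge together with a direction; [true] means backwards. *)
Definition step := (C * bool * bool)%type.
Implicit Types (s : step) (l : seq step).

Definition col s := s.1.1.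
Definition src E s := if s.2 then (E s.1).2 else (E s.1).1.
Definition tgt E s := if s.2 then (E s.1).1 else (E s.1).2.
Definition flip s : step := (s.1, ~~ s.2).

Definition link E s s' := tgt E s == src E s'.

Fixpoint walk E x l y :=
  if l is s :: l' then (src E s == x) && walk E (tgt E s) l' y else x == y.

Definition rainbow K l := uniq (map col l) && all (mem K) (map col l).

Definition circuit E K l := [&& l != [::], cycle (link E) l & rainbow K l].

(* [B] bounds twice the length, so that half-integral bounds need no rounding. *)
Definition has_circuit E K B := exists2 l, circuit E K l & (size l).*2 <= B.

Lemma src_flip E s : src E (flip s) = tgt E s.
Proof. by rewrite /src /tgt /=; case: s.2. Qed.

Lemma tgt_flip E s : tgt E (flip s) = src E s.
Proof. by rewrite /src /tgt /=; case: s.2. Qed.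

Lemma walk_cat E x y z l1 l2 :
  walk E x l1 y -> walk E y l2 z -> walk E x (l1 ++ l2) z.
Proof.
elim: l1 x => [|s l1 IH] x /=; first by move/eqP->.
by case/andP=> -> /IH; apply.
Qed.

Lemma walk_catP E x z l1 l2 :
  walk E x (l1 ++ l2) z -> exists2 y, walk E x l1 y & walk E y l2 z.
Proof.
elim: l1 x => [|s l1 IH] x /=; first by exists x.
by case/andP=> -> /IH [y w1 w2]; exists y.
Qed.

Lemma walk_path E x y s l :
  walk E x (s :: l) y =
  [&& src E s == x, path (link E) s l & tgt E (last s l) == y].
Proof.
elim: l x s => [|s' l IH] x s //; rewrite [LHS]/= -/(walk E _ (s' :: l) y) IH /=.
by rewrite /link (eq_sym (src E s')) !andbA.
Qed.

Lemma cycle_walk E s l :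
  cycle (link E) (s :: l) = walk E (src E s) (s :: l) (src E s).
Proof. by rewrite walk_path eqxx /= rcons_path. Qed.

Lemma rainbow_cons K s l :
  rainbow K (s :: l) = [&& col s \in K, col s \notin map col l & rainbow K l].
Proof.
by rewrite /rainbow /=; case: (_ \in K); case: (_ \notin _); rewrite ?andbF.
Qed.

Lemma rainbow_mem K s l : rainbow K l -> s \in l -> col s \in K.
Proof. by case/andP=> _ /allP h sl; apply: h; apply: map_f. Qed.

Lemma rainbow_rot K i l : rainbow K (rot i l) = rainbow K l.
Proof.
rewrite /rainbow map_rot rot_uniq; congr (_ && _).
by apply: eq_all_r => c; apply: mem_rot.
Qed.

Lemma rainbow_subseq K l1 l2 : subseq l1 l2 -> rainbow K l2 -> rainbow K l1.
Proof.
move=> /(map_subseq col) sub /andP[u /allP a]; rewrite /rainbow (subseq_uniq sub u).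
by apply/allP => c /(mem_subseq sub) /a.
Qed.

Lemma rainbow_sub K K' l : K \subset K' -> rainbow K l -> rainbow K' l.
Proof.
move=> /subsetP sub /andP[u /allP a]; rewrite /rainbow u /=.
by apply/allP => c /a /sub.
Qed.

Lemma rainbow_setU1 D s l : col s \notin D -> rainbow D l ->
  rainbow (col s |: D) (s :: l) /\ rainbow (col s |: D) (rcons l s).
Proof.
move=> sD r; have sl : col s \notin map col l.
  by apply: contra sD => /mapP [s' /(rainbow_mem r) s'D ->].
suff r' : rainbow (col s |: D) (s :: l) by split=> //; rewrite -rot1_cons rainbow_rot.
by rewrite rainbow_cons setU11 sl (rainbow_sub (subsetUr _ _) r).
Qed.

Lemma rainbow_cat K D l1 l2 : [disjoint K & D] ->
  rainbow K l1 -> rainbow D l2 -> rainbow (K :|: D) (l1 ++ l2).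
Proof.
move=> dis; elim: l1 => [|s l1 IH] /=.
  by move=> _; apply: rainbow_sub; apply: subsetUr.
rewrite !rainbow_cons => /and3P[sK sl1 /IH r1] r2; rewrite inE sK r1 // andbT /=.
rewrite map_cat mem_cat negb_or sl1; apply/mapP => -[s' s'l2 es].
by have := disjointFr dis sK; rewrite es (rainbow_mem r2 s'l2).
Qed.

Lemma size_rainbow K l : rainbow K l -> size l <= #|K|.
Proof.
case/andP=> u /allP a; rewrite -(size_map col) -(card_uniqP u).
by apply/subset_leq_card/subsetP.
Qed.

Lemma circuit_sub E K K' l : K \subset K' -> circuit E K l -> circuit E K' l.
Proof. by move=> sub /and3P[n c /(rainbow_sub sub) r]; apply/and3P. Qed.

Lemma has_circuit_mono E K K' B B' :
  K \subset K' -> B <= B' -> has_circuit E K B -> has_circuit E K' B'.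
Proof.
move=> sK leB [l cl le]; exists l; first exact: circuit_sub cl.
exact: leq_trans le leB.
Qed.

Lemma has_circuit_parity E K B : ~~ odd B -> has_circuit E K B.+1 -> has_circuit E K B.
Proof.
move=> oB [l cl le]; exists l => //; move: le; rewrite leq_eqVlt => /predU1P[e|//].
by move: oB; rewrite -[odd B]negbK -oddS -e odd_double.
Qed.

Lemma circuit_loop E K s : col s \in K -> src E s = tgt E s -> circuit E K [:: s].
Proof. by move=> sK e; rewrite /circuit rainbow_cons sK /= /link e eqxx. Qed.

Lemma circuit_digon E K s1 s2 : col s1 \in K -> col s2 \in K -> col s1 != col s2 ->
  tgt E s1 = src E s2 -> tgt E s2 = src E s1 -> circuit E K [:: s1; s2].
Proof.
move=> K1 K2 n12 e12 e21.
by rewrite /circuit !rainbow_cons K1 K2 /= /link inE n12 e12 e21 !eqxx.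
Qed.

Lemma circuit_triangle E K s1 s2 s3 : rainbow K [:: s1; s2; s3] ->
  tgt E s1 = src E s2 -> tgt E s2 = src E s3 -> tgt E s3 = src E s1 ->
  circuit E K [:: s1; s2; s3].
Proof. by move=> r e12 e23 e31; rewrite /circuit r /= /link e12 e23 e31 !eqxx. Qed.

Lemma shorter_cycle E x l y : walk E x l y -> ~~ uniq (map (src E) l) ->
  exists l', [/\ l' != [::], cycle (link E) l', subseq l' l & size l' < size l].
Proof.
elim: l x => //= s l IH x /andP[_ w]; rewrite negb_and negbK => /orP[|nu].
  case/mapP=> s' s'l es; case/splitPr: s'l w => l1 l2 /walk_catP [z w1].
  case/andP=> /eqP ez _; exists (s :: l1); split=> //.
  - by rewrite cycle_walk /= eqxx es ez.
  - by rewrite /= eqxx prefix_subseq.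
  - by rewrite /= ltnS size_cat /= addnS ltnS leq_addr.
have [l' [n c sub lt]] := IH _ w nu.
by exists l'; split=> //; [apply: subseq_trans sub (subseq_cons _ _) | apply: ltnW].
Qed.

Lemma simple_circuit E K l : circuit E K l ->
  exists l', [/\ circuit E K l', uniq (map (src E) l') & subseq l' l].
Proof.
have [n] := ubnP (size l); elim: n l => // n IH l lt cl.
have [u|nu] := boolP (uniq (map (src E) l)); first by exists l.
have w : exists x, walk E x l x.
  by case: l cl {lt nu IH} => // s l /and3P[_]; rewrite cycle_walk; exists (src E s).
case: w => x /shorter_cycle /(_ nu) [l1 [n1 c1 sub1 lt1]].
have cl1 : circuit E K l1.
  by apply/and3P; split=> //; apply: rainbow_subseq sub1 _; case/and3P: cl.
have [l2 [cl2 u2 sub2]] := IH l1 (leq_trans lt1 lt) cl1.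
by exists l2; split=> //; apply: subseq_trans sub1.
Qed.

Lemma circuit_once E K l v : circuit E K l -> exists s l',
  [/\ circuit E K (s :: l'), v \notin map (src E) l' & {subset s :: l' <= l}].
Proof.
case/simple_circuit => l0 [cl0 u0 /mem_subseq sub0].
have [vl0|vl0] := boolP (v \in map (src E) l0); last first.
  by case: l0 cl0 vl0 sub0 {u0} => // s l' cl0 /= /norP[_ vl'] sub0; exists s, l'.
have [i vs ei] := rot_to vl0; have crot : circuit E K (rot i l0).
  case/and3P: cl0 => n0 c0 r0; apply/and3P; split.
  - by rewrite -size_eq0 size_rot size_eq0.
  - by rewrite rot_cycle.
  - by rewrite rainbow_rot.
have : uniq (map (src E) (rot i l0)) by rewrite map_rot rot_uniq.
have {}sub0 : {subset rot i l0 <= l} by move=> s; rewrite mem_rot; apply: sub0.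
move: ei sub0 crot; rewrite -map_rot.
case: (rot i l0) => // s l' [<- _] sub cl /= /andP[nsl' _].
by exists s, l'.
Qed.

End Walks.

Lemma set2_inj (A : finType) (x y x' y' : A) : [set x; y] = [set x'; y'] ->
  (x = x' /\ y = y') \/ (x = y' /\ y = x').
Proof.
move=> e; have: x \in [set x'; y'] by rewrite -e set21.
have: y \in [set x'; y'] by rewrite -e set22.
have: x' \in [set x; y] by rewrite e set21.
have: y' \in [set x; y] by rewrite e set22.
by rewrite !inE; do 4![case/pred2P=> ?]; subst; auto.
Qed.

(** * Contraction *)

Section Contraction.
Variables T C : finType.
Implicit Types (E : C * bool -> T * T) (e : C * bool) (K D : {set C}).
Implicit Types (x y z q : T) (X Q : {set T}) (s : step C) (l : seq (step C)).

Definition ends E e : {set T} := [set (E e).1; (E e).2].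

Definition edges_in E K X := forall e, e.1 \in K -> ends E e \subset X.

Definition parallel E c := ends E (c, false) == ends E (c, true).

Lemma ends_step E s : ends E s.1 = [set src E s; tgt E s].
Proof. by rewrite /ends /src /tgt; case: s.2 => //; rewrite setUC. Qed.

Lemma src_ends E s : src E s \in ends E s.1.
Proof. by rewrite ends_step set21. Qed.

Lemma tgt_ends E s : tgt E s \in ends E s.1.
Proof. by rewrite ends_step set22. Qed.

Lemma step_of_ends E e x y : ends E e = [set x; y] ->
  exists o, src E (e, o) = x /\ tgt E (e, o) = y.
Proof. by case/set2_inj => -[<- <-]; [exists false | exists true]. Qed.

Lemma ends_eqP E e e' : reflect
  (exists o, src E (e, false) = src E (e', o) /\ tgt E (e, false) = tgt E (e', o))
  (ends E e == ends E e').
Proof.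
apply: (iffP eqP) => [/esym/step_of_ends [o [es et]]|[o [es et]]].
  by exists o; rewrite es et.
by rewrite (ends_step E (e, false)) es et -ends_step.
Qed.

Definition other_end (p : T * T) x := if p.1 == x then p.2 else p.1.

Lemma step_from E e x : x \in ends E e ->
  exists o, src E (e, o) = x /\ tgt E (e, o) = other_end (E e) x.
Proof.
rewrite /other_end /src /tgt !inE /=.
by have [->|_] := eqVneq x (E e).1; [exists false | move=> /eqP ->; exists true].
Qed.

Lemma ends_other E e x : x \in ends E e -> ends E e = [set x; other_end (E e) x].
Proof. by case/step_from=> o [<- <-]; rewrite -(ends_step E (e, o)). Qed.

Lemma edges_in_sub E K K' X : K' \subset K -> edges_in E K X -> edges_in E K' X.
Proof. by move=> /subsetP sub EX e /sub; apply: EX. Qed.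

Lemma src_in E K X s : edges_in E K X -> col s \in K -> src E s \in X.
Proof. by move=> EX /EX/subsetP; apply; apply: src_ends. Qed.

Definition contract Q q x := if x \in Q then q else x.
Definition contracted E Q q e := (contract Q q (E e).1, contract Q q (E e).2).

Lemma src_contracted E Q q s : src (contracted E Q q) s = contract Q q (src E s).
Proof. by rewrite /src /=; case: s.2. Qed.

Lemma tgt_contracted E Q q s : tgt (contracted E Q q) s = contract Q q (tgt E s).
Proof. by rewrite /tgt /=; case: s.2. Qed.

Lemma contract_neq Q q x : contract Q q x != q -> contract Q q x = x.
Proof. by rewrite /contract; case: ifP => //; rewrite eqxx. Qed.

Lemma contract_set2 x q y : y != x -> contract [set x; q] q y = y.
Proof. by rewrite /contract !inE => /negbTE ->; case: eqP. Qed.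

Lemma contract_eq Q q x y : q \in Q -> contract Q q x = contract Q q y ->
  x = y \/ (x \in Q /\ y \in Q).
Proof.
move=> qQ; rewrite /contract; case: ifP => xQ; case: ifP => yQ e; try by auto.
- by rewrite -e qQ in yQ.
- by rewrite e qQ in xQ.
Qed.

Lemma contracted_in E K X Q q : q \in Q -> Q \subset X -> edges_in E K X ->
  edges_in (contracted E Q q) K (q |: (X :\: Q)).
Proof.
move=> qQ QX EX e /EX; rewrite /ends !subUset !sub1set /= /contract => /andP[e1 e2].
by rewrite !inE; case: ifP => [_|->]; case: ifP => [_|->]; rewrite ?eqxx ?e1 ?e2 ?orbT.
Qed.

Lemma card_contracted X Q q : q \in Q -> Q \subset X ->
  #|q |: (X :\: Q)| + #|Q| = #|X|.+1.
Proof.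
move=> qQ QX; rewrite cardsU1 !inE qQ /= add1n addSn; congr _.+1.
by rewrite cardsD (setIidPr QX) subnK // subset_leq_card.
Qed.

Definition rainbow_diameter_le E D Q d := forall x y, x \in Q -> y \in Q ->
  exists l, [/\ walk E x l y, rainbow D l & size l <= d].

Lemma walk_uncontract E Q q s l y :
  walk (contracted E Q q) (src (contracted E Q q) s) (s :: l) y ->
  q \notin map (src (contracted E Q q)) l ->
  exists2 z, walk E (src E s) (s :: l) z & contract Q q z = y.
Proof.
elim: l s => [|s' l IH] s.
  rewrite /= eqxx => /eqP <- _; exists (tgt E s); last by rewrite tgt_contracted.
  by rewrite /= !eqxx.
rewrite inE negb_or => w /andP[qs' ql].
have /andP[_ /andP[/eqP es' w']] := w.
have [|z wz ez] := IH s' _ ql; first by rewrite /= eqxx.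
rewrite walk_path eqxx in wz; have /and3P[_ path_l tgt_z] := wz.
exists z => //; rewrite walk_path eqxx /= path_l tgt_z !andbT /link.
rewrite eq_sym in qs'; move: (qs'); rewrite src_contracted => /contract_neq <-.
by rewrite -src_contracted es' tgt_contracted contract_neq // -tgt_contracted -es'.
Qed.

(* A circuit can be chosen to pass through [q] at most once, so undoing the
   contraction breaks it in at most one place. *)
Lemma uncontract_circuit E K D Q q d l : q \in Q -> [disjoint K & D] ->
  rainbow_diameter_le E D Q d -> circuit (contracted E Q q) K l ->
  exists l1 l2, [/\ circuit E (K :|: D) (l1 ++ l2), uniq l1, {subset l1 <= l},
    rainbow D l2 & size l2 <= d].
Proof.
move=> qQ disj diam /(circuit_once q) [s [l1 [/and3P[_ c r] ql1 sub]]].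
rewrite cycle_walk in c; have [z w ez] := walk_uncontract c ql1.
have us : uniq (s :: l1) by rewrite (map_uniq (f := @col C)) //; case/andP: r.
exists (s :: l1); rewrite src_contracted in ez.
have [zs|[zQ sQ]] := contract_eq qQ ez.
  exists [::]; split=> //; rewrite cats0 /circuit cycle_walk -{2}zs w.
  exact: rainbow_sub (subsetUl _ _) r.
have [l2 [w2 r2 d2]] := diam _ _ zQ sQ; exists l2; split=> //.
by rewrite /circuit cycle_walk -cat_cons (walk_cat w w2) rainbow_cat.
Qed.

Lemma has_circuit_contract E K D Q q d B :
  q \in Q -> D \subset K -> rainbow_diameter_le E D Q d ->
  has_circuit (contracted E Q q) (K :\: D) B -> has_circuit E K (B + d.*2).
Proof.
move=> qQ DK diam [l cl le]; have disj : [disjoint K :\: D & D].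
  by rewrite disjoints_subset setDE subsetIr.
have [l1 [l2 [cl' /uniq_leq_size size_l1 /size_l1 {}size_l1 _ d2]]] :=
  uncontract_circuit qQ disj diam cl.
exists (l1 ++ l2); first by apply: circuit_sub cl'; rewrite subUset subsetDl.
by rewrite size_cat doubleD leq_add ?leq_double // (leq_trans _ le) ?leq_double.
Qed.

Lemma rainbow_edge D e o : e.1 \in D -> rainbow D [:: (e, o)].
Proof. by move=> eD; rewrite rainbow_cons eD. Qed.

Lemma edge_diameter E D e : e.1 \in D -> rainbow_diameter_le E D (ends E e) 1.
Proof.
move=> eD x y; rewrite !inE => /orP[]/eqP-> /orP[]/eqP->.
- by exists [::]; rewrite /= eqxx.
- by exists [:: (e, false)]; rewrite rainbow_edge //= !eqxx.
- by exists [:: (e, true)]; rewrite rainbow_edge //= !eqxx.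
- by exists [::]; rewrite /= eqxx.
Qed.

Lemma exists_circuit E K X : edges_in E K X -> 0 < #|X| <= #|K| ->
  has_circuit E K #|K|.*2.
Proof.
suff: edges_in E K X -> 0 < #|X| <= #|K| -> exists B, has_circuit E K B.
  move=> ex EX XK; have [B [l cl _]] := ex EX XK; exists l => //.
  by rewrite leq_double; apply: size_rainbow; case/and3P: cl.
have [n] := ubnP #|X|; elim: n E K X => // n IH E K X ltn EX /andP[X0 XK].
have [c cK] : exists c, c \in K by apply/set0Pn; rewrite -card_gt0 (leq_trans X0).
pose e := (c, false); have [loop|ne] := eqVneq (E e).1 (E e).2.
  by exists 2, [:: (e, false)] => //; apply: circuit_loop.
have qQ : (E e).1 \in ends E e by rewrite set21.
pose X' := (E e).1 |: (X :\: ends E e).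
have cX' : #|X'| + 2 = #|X|.+1 by rewrite -(card_contracted qQ (EX e cK)) cards2 ne.
have X'0 : 0 < #|X'| by apply/card_gt0P; exists (E e).1; apply: setU11.
have [] := IH (contracted E (ends E e) (E e).1) (K :\ c) X'.
- by lia.
- by apply: edges_in_sub (subD1set _ _) _; apply: contracted_in => //; apply: EX.
- by have := cardsD1 c K; rewrite cK; lia.
move=> B cB; exists (B + 1.*2); apply: has_circuit_contract qQ _ _ cB.
  by rewrite sub1set.
by apply: edge_diameter; rewrite inE.
Qed.

Lemma parallel_contracted E Q q c : q \in Q -> parallel (contracted E Q q) c ->
  ~~ parallel E c -> (forall b, ~~ (ends E (c, b) \subset Q)) ->
  exists s1 s2, [/\ s1.1 = (c, false), s2.1 = (c, true), src E s1 = src E s2,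
    tgt E s1 != tgt E s2 & [/\ src E s1 \notin Q, tgt E s1 \in Q & tgt E s2 \in Q]].
Proof.
move=> qQ /ends_eqP [o []]; rewrite !src_contracted !tgt_contracted.
move=> /(contract_eq qQ) src_o /(contract_eq qQ) tgt_o /ends_eqP np no_chord.
have notin s b : s.1 = (c, b) -> tgt E s \in Q -> src E s \notin Q.
  move=> es tQ; apply/negP => sQ; case/negP: (no_chord b).
  by rewrite -es ends_step subUset !sub1set sQ.
case: src_o tgt_o => [src_o|[sQ sQ']] [tgt_o|[tQ tQ']].
- by case: np; exists o.
- exists ((c, false), false), ((c, true), o); split=> //.
    by apply/eqP => tgt_o; case: np; exists o.
  by split=> //; apply: notin tQ.
- exists (flip ((c, false), false)), (flip ((c, true), o)).
  rewrite !src_flip !tgt_flip; split=> //.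
    by apply/eqP => src_o; case: np; exists o.
  split=> //; have := notin (flip ((c, false), false)) false.
  by rewrite src_flip tgt_flip; apply.
- by have := notin ((c, false), false) false erefl tQ; rewrite sQ.
Qed.

End Contraction.

Section Reindexing.
Variables T C C' : finType.
Implicit Types (E : C * bool -> T * T) (f : C' * bool -> C * bool).

Lemma has_circuit_reindex E f (K : {set C}) (K' : {set C'}) B :
  (forall e, e.1 \in K' -> (f e).1 \in K) ->
  (forall e e', e.1 \in K' -> e'.1 \in K' -> (f e).1 = (f e').1 -> e.1 = e'.1) ->
  has_circuit (E \o f) K' B -> has_circuit E K B.
Proof.
move=> fK f_inj [l /and3P[n c r] le]; pose g (s : step C') : step C := (f s.1, s.2).
exists (map g l); last by rewrite size_map.
apply/and3P; split; first by case: l n {c r le}.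
  by rewrite cycle_map.
elim: l r {n c le} => //= s l IH; rewrite !rainbow_cons => /and3P[sK sl rl].
rewrite {}IH // andbT fK //; apply: contra sl => /mapP [_ /mapP [s' s'l ->] e].
by apply/mapP; exists s' => //; apply: f_inj => //; apply: rainbow_mem s'l.
Qed.

End Reindexing.

Lemma has_circuit_select (T C : finType) (E : C * bool -> T * T)
    (b : C * bool -> bool) (K : {set C}) B :
  has_circuit (fun e => E (e.1, b e)) K B -> has_circuit E K B.
Proof. by apply: (has_circuit_reindex (f := fun e => (e.1, b e))) => -[]. Qed.

Lemma mem_of_miss_one (A : finType) (B B' : {set A}) x y :
  B \subset B' -> #|B'| <= #|B|.+1 -> x \in B' -> y \in B' -> x != y ->
  (x \in B) || (y \in B).
Proof.
move=> sub le xB' yB' xy; rewrite -[_ || _]negbK negb_or; apply/negP => /andP[xB yB].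
have : [set x; y] \subset B' :\: B by rewrite subUset !sub1set !inE xB yB xB'.
by move/subset_leq_card; rewrite cards2 xy cardsD (setIidPr sub); lia.
Qed.

(** * Clusters *)

Section Balls.
Variables T C : finType.
Implicit Types (E : C * bool -> T * T) (D : {set C}) (A Q : {set T}) (x y z : T).
Implicit Types (s : step C) (i d : nat).

Definition ball E D Q A i := [set z in Q |
  `[< exists y l, [/\ y \in A, walk E y l z, rainbow D l & size l <= i] >]].

Lemma ballP E D Q A i z : reflect
  (z \in Q /\ exists y l, [/\ y \in A, walk E y l z, rainbow D l & size l <= i])
  (z \in ball E D Q A i).
Proof. by rewrite inE; apply: (iffP andP) => -[? /asboolP]. Qed.

Lemma ball_sub E D Q A i : ball E D Q A i \subset Q.
Proof. by apply/subsetP => z /ballP[]. Qed.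

Lemma sub_ball E D Q A i : A \subset Q -> A \subset ball E D Q A i.
Proof.
move=> /subsetP AQ; apply/subsetP => z zA; apply/ballP; split; first exact: AQ.
by exists z, [::]; rewrite /= eqxx.
Qed.

Lemma ball_mono E D D' Q Q' A A' i : D \subset D' -> Q \subset Q' -> A \subset A' ->
  ball E D Q A i \subset ball E D' Q' A' i.
Proof.
move=> DD' /subsetP QQ' /subsetP AA'; apply/subsetP => z /ballP[zQ [y [l [yA w r le]]]].
apply/ballP; split; first exact: QQ'.
by exists y, l; split=> //; [apply: AA' | apply: rainbow_sub r].
Qed.

Lemma ball_rcons E D Q A i s : tgt E s \in ball E D Q A i -> col s \notin D ->
  src E s \in ball E (col s |: D) (src E s |: Q) A i.+1.
Proof.
move=> /ballP[_ [y [l [yA w r le]]]] sD; apply/ballP; rewrite setU11; split=> //.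
exists y, (rcons l (flip s)); split=> //; last by rewrite size_rcons.
  by rewrite -cats1; apply: walk_cat w _; rewrite /= src_flip tgt_flip !eqxx.
by have [] := rainbow_setU1 (s := flip s) sD r.
Qed.

Lemma ball_cons E D Q A A' c x i : c \notin D -> x \in A ->
  (forall y, y \in A' -> exists s, [/\ col s = c, src E s = x & tgt E s = y]) ->
  ball E D Q A' i \subset ball E (c |: D) (x |: Q) A i.+1.
Proof.
move=> cD xA edge; apply/subsetP => z /ballP[zQ [y [l [/edge [s [sc sx sy]] w r le]]]].
apply/ballP; rewrite inE zQ orbT; split=> //; exists x, (s :: l).
by rewrite -{}sc in cD *; split=> //=; [rewrite sx sy eqxx | case: (rainbow_setU1 cD r)].
Qed.

(* Balls grow at least as fast as on the square of a path. *)
Definition expands E D Q := forall A i, A \subset Q -> A != set0 ->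
  minn #|Q| (#|A| + i.*2) <= #|ball E D Q A i|.

Lemma expands_diameter E D Q : expands E D Q -> rainbow_diameter_le E D Q #|Q|./2.
Proof.
move=> exp x y xQ yQ; have := exp [set x] #|Q|./2; rewrite sub1set cards1 => /(_ xQ).
rewrite -card_gt0 cards1 => /(_ isT) le.
have bQ : ball E D Q [set x] #|Q|./2 = Q.
  by apply: subset_card_eq (ball_sub _ _ _ _ _) _; lia.
move: yQ; rewrite -{1}bQ => /ballP[_ [_ [l [/set1P -> w r s]]]].
by exists l.
Qed.

Lemma expands_diameter1 E D Q : rainbow_diameter_le E D Q 1 -> expands E D Q.
Proof.
move=> diam A [|i] AQ A0.
  by rewrite addn0; apply: leq_trans (geq_minr _ _) _; apply/subset_leq_card/sub_ball.
apply: leq_trans (geq_minl _ _) _; apply/subset_leq_card/subsetP => z zQ.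
have [x xA] := set0Pn _ A0; have [l [w r le]] := diam x z (subsetP AQ x xA) zQ.
by apply/ballP; split=> //; exists x, l; split=> //; apply: leq_trans le _.
Qed.

Section Extend.
Variables (E : C * bool -> T * T) (D : {set C}) (Q : {set T}) (s1 s2 : step C).
Hypotheses (expQ : expands E D Q) (newD : col s1 \notin D) (col12 : col s2 = col s1)
  (src12 : src E s2 = src E s1) (newQ : src E s1 \notin Q)
  (tgtQ1 : tgt E s1 \in Q) (tgtQ2 : tgt E s2 \in Q) (tgt12 : tgt E s1 != tgt E s2).

Local Notation x := (src E s1).
Local Notation D' := (col s1 |: D).
Local Notation Q' := (x |: Q).

Let card_Q' : #|Q'| = #|Q|.+1. Proof. by rewrite cardsU1 newQ. Qed.

Let card_U1_ball A i : #|x |: ball E D Q A i| = #|ball E D Q A i|.+1.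
Proof. by rewrite cardsU1 (contra (subsetP (ball_sub _ _ _ _ _) _)). Qed.

Lemma ball_extend_in A i : A \subset Q' -> x \in A ->
  minn #|Q'| (#|A| + i.*2) <= #|ball E D' Q' A i|.
Proof.
move=> AQ' xA; have xb j : x \in ball E D' Q' A j.
  exact: (subsetP (sub_ball _ _ _ AQ')).
have [Ax0|Ax0] := eqVneq (A :\ x) set0.
  have A1 : #|A| = 1 by rewrite (cardsD1 x) xA Ax0 cards0.
  case: i => [|i].
    by apply: leq_trans (geq_minr _ _) _; rewrite A1 card_gt0; apply/set0Pn; exists x.
  have sub : x |: ball E D Q [set tgt E s1; tgt E s2] i \subset ball E D' Q' A i.+1.
    rewrite subUset sub1set xb; apply: ball_cons => // y /set2P[]->; last by exists s2.
    by exists s1.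
  have := expQ (A := [set tgt E s1; tgt E s2]) i.
  rewrite subUset !sub1set tgtQ1 tgtQ2 -card_gt0 cards2 tgt12 A1 => /(_ isT isT).
  by have := subset_leq_card sub; rewrite card_U1_ball card_Q'; clear; lia.
have AQ : A :\ x \subset Q by rewrite subDset.
have sub : x |: ball E D Q (A :\ x) i \subset ball E D' Q' A i.
  by rewrite subUset sub1set xb ball_mono ?subsetUr ?subD1set.
have := subset_leq_card sub; have := expQ i AQ Ax0; have := cardsD1 x A.
by rewrite xA card_U1_ball card_Q'; clear; lia.
Qed.

Lemma ball_extend_notin A i : A \subset Q -> A != set0 ->
  minn #|Q'| (#|A| + i.*2) <= #|ball E D' Q' A i|.
Proof.
move=> AQ A0; have grow := expQ i AQ A0.
have mono := ball_mono E i (subsetUr [set col s1] D) (subsetUr [set x] Q) (subxx A).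
have [small|large] := leqP (#|A| + i.*2) #|Q|.
  by have := subset_leq_card mono; rewrite card_Q'; move: small grow; clear; lia.
have full : ball E D Q A i = Q.
  apply: subset_card_eq (ball_sub _ _ _ _ _) _.
  by move: large grow; clear; lia.
case: i {grow} large mono full => [|i] large mono full.
  by have := subset_leq_card AQ; move: large; clear; lia.
have miss : #|Q| <= #|ball E D Q A i|.+1.
  by have := expQ i AQ A0; move: large; clear; lia.
have xb : x \in ball E D' Q' A i.+1.
  have := mem_of_miss_one (ball_sub _ _ _ _ _) miss tgtQ1 tgtQ2 tgt12.
  by case/orP=> /ball_rcons; rewrite ?src12 ?col12; apply.
apply: leq_trans (geq_minl _ _) _; apply: subset_leq_card.
by rewrite subUset sub1set xb -{1}full.
Qed.

Lemma expands_extend : expands E D' Q'.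
Proof.
move=> A i AQ' A0; have [xA|xA] := boolP (x \in A); first exact: ball_extend_in.
apply: ball_extend_notin => //; apply/subsetP => y yA.
by case/setU1P: (subsetP AQ' y yA) => // yx; rewrite -yx yA in xA.
Qed.

End Extend.

End Balls.

Section Clusters.
Variables T C : finType.
Implicit Types (E : C * bool -> T * T) (e : C * bool) (K D : {set C}).
Implicit Types (X Q : {set T}) (s : step C).

(* A cluster starts from an edge of [c0] and is enlarged by a vertex that both
   edges of a new colour join to it. *)
Definition cluster E X K c0 Q D :=
  [/\ Q \subset X, D \subset K, c0 \in D, #|Q| = #|D|.+1 & expands E D Q].

Lemma cluster_edge E X K c b : edges_in E K X -> c \in K ->
  (E (c, b)).1 != (E (c, b)).2 -> cluster E X K c (ends E (c, b)) [set c].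
Proof.
move=> EX cK noloop; split.
- exact: EX.
- by rewrite sub1set.
- exact: set11.
- by rewrite cards1 cards2 noloop.
- by apply/expands_diameter1/edge_diameter; rewrite inE.
Qed.

Lemma cluster_extend E X K c0 Q D s1 s2 : cluster E X K c0 Q D ->
  col s1 \in K :\: D -> col s2 = col s1 ->
  src E s1 = src E s2 -> tgt E s1 != tgt E s2 ->
  src E s1 \in X :\: Q -> tgt E s1 \in Q -> tgt E s2 \in Q ->
  cluster E X K c0 (src E s1 |: Q) (col s1 |: D).
Proof.
move=> [QX DK c0D cQ expQ] /setDP[sK sD] e12 src12 tgt12 /setDP[sX sQ] t1 t2.
split; last by apply: expands_extend expQ _ e12 _ _ t1 t2 _.
- by rewrite subUset sub1set sX.
- by rewrite subUset sub1set sK.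
- by rewrite inE c0D orbT.
- by rewrite !cardsU1 sQ sD cQ.
Qed.

Lemma max_cluster E X K c0 Q D : cluster E X K c0 Q D -> exists Q' D',
  cluster E X K c0 Q' D' /\
  forall Q'' D'', cluster E X K c0 Q'' D'' -> #|Q''| <= #|Q'|.
Proof.
pose P (p : {set T} * {set C}) := `[< cluster E X K c0 p.1 p.2 >].
move=> cl; have P0 : P (Q, D) by apply/asboolP.
case: (arg_maxnP (fun p : {set T} * {set C} => #|p.1|) P0) => -[Q' D'] /asboolP cl' mx.
by exists Q', D'; split=> // Q'' D'' cl''; apply: (mx (Q'', D'')); apply/asboolP.
Qed.

End Clusters.

(** * The girth bound in the presence of parallel or superfluous colours *)

Section Bound.
Variables T C : finType.
Implicit Types (E : C * bool -> T * T) (e : C * bool) (K D : {set C}).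
Implicit Types (X Q : {set T}) (s : step C) (m : nat).

Definition num_parallel E K := #|[set c in K | parallel E c]|.

Definition girth_bound m := forall E K X, #|X| = m -> #|K| = m -> 0 < m ->
  edges_in E K X -> has_circuit E K (m + num_parallel E K).+1.

Lemma num_parallel0 E K : (forall c, c \in K -> ~~ parallel E c) -> num_parallel E K = 0.
Proof.
by move=> np; apply: eq_card0 => c; rewrite inE; apply/andP => -[/np/negbTE->].
Qed.

Lemma num_parallel_gt0 E K c : c \in K -> parallel E c -> 0 < num_parallel E K.
Proof. by move=> cK pc; apply/card_gt0P; exists c; rewrite inE cK. Qed.

Lemma num_parallel_le E K : num_parallel E K <= #|K|.
Proof. by apply/subset_leq_card/subsetP => c; rewrite inE => /andP[]. Qed.

Lemma has_circuit_chord E K D Q d e : D \subset K -> rainbow_diameter_le E D Q d ->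
  e.1 \in K :\: D -> ends E e \subset Q -> has_circuit E K d.+1.*2.
Proof.
move=> DK diam /setDP[eK eD]; rewrite (ends_step E (e, false)) subUset !sub1set.
case/andP=> srcQ tgtQ; have [l [w r le]] := diam _ _ tgtQ srcQ.
exists ((e, false) :: l); last by rewrite leq_double.
rewrite /circuit cycle_walk /= eqxx w.
have [+ _] := rainbow_setU1 (s := (e, false)) eD r; apply: rainbow_sub.
by rewrite subUset sub1set eK.
Qed.

(* Otherwise the cluster could be enlarged. *)
Lemma max_cluster_parallel E X K c0 Q D q c : cluster E X K c0 Q D ->
  (forall Q' D', cluster E X K c0 Q' D' -> #|Q'| <= #|Q|) -> edges_in E K X ->
  (forall e, e.1 \in K :\: D -> ~~ (ends E e \subset Q)) ->
  q \in Q -> c \in K :\: D -> parallel (contracted E Q q) c -> parallel E c.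
Proof.
move=> cl mx EX no_chord qQ cKD pc; apply/negPn/negP => npc.
have [s1 [s2 [e1 e2 src12 tgt12 [srcQ t1Q t2Q]]]] :=
  parallel_contracted qQ pc npc (fun b => no_chord (c, b) cKD).
have col1 : col s1 = c by rewrite /col e1.
have col2 : col s2 = col s1 by rewrite col1 /col e2.
have : cluster E X K c0 (src E s1 |: Q) (col s1 |: D).
  apply: cluster_extend cl _ col2 src12 tgt12 _ t1Q t2Q; rewrite ?col1 //.
  by rewrite inE srcQ (src_in EX) // col1; case/setDP: cKD.
by move/mx; rewrite cardsU1 srcQ ltnn.
Qed.

Lemma girth_bound_parallel m E K X c0 : (forall m', m' < m -> girth_bound m') ->
  #|X| = m -> #|K| = m -> edges_in E K X -> c0 \in K -> parallel E c0 ->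
  has_circuit E K (m + num_parallel E K).+1.
Proof.
move=> bound_lt card_X card_K EX c0K pc0; have p_gt0 := num_parallel_gt0 c0K pc0.
have [loop|noloop] := eqVneq (E (c0, false)).1 (E (c0, false)).2.
  exists [:: (c0, false, false)]; first exact: circuit_loop.
  by rewrite ltnS (leq_trans p_gt0) ?leq_addl.
have [Q [D [cl mx]]] := max_cluster (cluster_edge EX c0K noloop).
have [QX DK c0D card_Q /expands_diameter diam] := cl.
have Qm : #|Q| <= m by rewrite -card_X subset_leq_card.
have [/existsP [e /andP[eKD eQ]]|/existsPn no_chord] :=
    boolP [exists e : C * bool, (e.1 \in K :\: D) && (ends E e \subset Q)].
  apply: has_circuit_mono (has_circuit_chord DK diam eKD eQ) => //.
  by move: Qm p_gt0; clear; lia.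
have [q qQ] : exists q, q \in Q by apply/card_gt0P; rewrite card_Q.
pose X' := q |: (X :\: Q); pose E' := contracted E Q q.
have card_X' : #|X'| + #|Q| = m.+1 by rewrite card_contracted // card_X.
have card_K' : #|K :\: D| = #|X'|.
  by rewrite cardsD (setIidPr DK) card_K; move: card_X' card_Q; clear; lia.
have X'_gt0 : 0 < #|X'| by apply/card_gt0P; exists q; apply: setU11.
have E'X' : edges_in E' (K :\: D) X'.
  by apply: edges_in_sub (subsetDl _ _) _; apply: contracted_in.
have p_lt : num_parallel E' (K :\: D) < num_parallel E K.
  rewrite [X in _ < X](cardsD1 c0) inE c0K pc0 ltnS; apply/subset_leq_card/subsetP => c.
  rewrite !inE -andbA => /and3P[cD cKc pc].
  have cKD : c \in K :\: D by rewrite inE cD.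
  have -> : c != c0 by apply: contraNneq cD => ->.
  rewrite cKc (max_cluster_parallel cl mx EX _ qQ cKD pc) // => e eKD.
  by have := no_chord e; rewrite eKD.
have D_gt0 : 0 < #|D| by apply/card_gt0P; exists c0.
have X'm : #|X'| < m by move: card_X' card_Q D_gt0; clear; lia.
have cB := bound_lt _ X'm _ _ _ erefl card_K' X'_gt0 E'X'.
apply: has_circuit_mono (has_circuit_contract qQ DK diam cB) => //.
by move: card_X' p_lt; clear; lia.
Qed.

Lemma girth_bound_odd m E K X : (forall m', m' < m -> girth_bound m') -> odd m ->
  #|X| = m -> #|K| = m -> edges_in E K X -> (forall c, c \in K -> ~~ parallel E c) ->
  has_circuit E K m.+1.
Proof.
move=> bound_lt odd_m card_X card_K EX no_parallel.
apply: has_circuit_parity; first by rewrite /= odd_m.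
have [c0 c0K] : exists c0, c0 \in K by apply/card_gt0P; rewrite card_K odd_gt0.
pose b (e : C * bool) := (e.1 != c0) && e.2.
apply: (has_circuit_select (b := b)); set E' := fun e => _.
have pc0 : parallel E' c0 by rewrite /parallel /E' /b /ends /= eqxx.
have p_le1 : num_parallel E' K <= 1.
  rewrite -(cards1 c0); apply/subset_leq_card/subsetP => c.
  rewrite !inE => /andP[cK']; apply: contraTT => ne.
  by have := no_parallel c cK'; rewrite /parallel /E' /b /ends /= ne.
have E'X : edges_in E' K X by move=> e eK; apply: EX.
apply: has_circuit_mono (girth_bound_parallel bound_lt card_X card_K E'X c0K pc0) => //.
by rewrite ltnS -addn1 leq_add2l.
Qed.

(* The parallel colours [c1] and [c2] become one colour [c1], whose edges are
   one edge of each. *)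
Definition bundle (c1 c2 : C) (e : C * bool) : C * bool :=
  if e.1 == c1 then (if e.2 then c2 else c1, false) else e.

Lemma bundle_in K c1 c2 e : c1 \in K -> c2 \in K -> e.1 \in K ->
  (bundle c1 c2 e).1 \in K.
Proof. by move=> c1K c2K eK; rewrite /bundle; case: ifP => //= _; case: e.2. Qed.

Lemma bundle_inj K c1 c2 e e' : e.1 \in K :\ c2 -> e'.1 \in K :\ c2 ->
  (bundle c1 c2 e).1 = (bundle c1 c2 e').1 -> e.1 = e'.1.
Proof.
case: e e' => [c b] [c' b']; rewrite /bundle /= => /setD1P[cc2 _] /setD1P[c'c2 _].
case: eqP => [->|_]; case: eqP => [->|_] //=.
- by case: b => // ec; rewrite -ec eqxx in c'c2.
- by case: b' => // ec; rewrite ec eqxx in cc2.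
Qed.

Lemma num_parallel_bundle E K c1 c2 : c1 \in K -> c2 \in K -> c1 != c2 ->
  parallel E c1 -> parallel E c2 -> ends E (c1, false) != ends E (c2, false) ->
  num_parallel (E \o bundle c1 c2) (K :\ c2) + 2 <= num_parallel E K.
Proof.
move=> c1K c2K c12 p1 p2 ne12; pose P := [set c in K | parallel E c].
have sub : [set c in K :\ c2 | parallel (E \o bundle c1 c2) c] \subset P :\ c1 :\ c2.
  apply/subsetP => c; rewrite !inE -andbA => /and3P[-> ->].
  rewrite /parallel /ends /= /bundle /=; case: (c =P c1) => //= _ pc.
  by rewrite /ends (eqP pc) eqxx in ne12.
have := cardsD1 c1 P; have := cardsD1 c2 (P :\ c1); have := subset_leq_card sub.
by rewrite !inE c1K c2K p1 p2 eq_sym c12 /num_parallel -/P /=; lia.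
Qed.

Lemma has_circuit_nonparallel E K X B : girth_bound #|X| -> 0 < #|X| ->
  #|X| <= #|[set c in K | ~~ parallel E c]| -> edges_in E K X -> #|X| < B ->
  has_circuit E K B.
Proof.
move=> bound X0 /ex_subset_card [K' sub cK'] EX XB.
have K'K : K' \subset K by apply: subset_trans sub _; apply/subsetP => c /setIdP[].
apply: has_circuit_mono K'K _ (bound E K' X erefl cK' X0 (edges_in_sub K'K EX)).
by rewrite num_parallel0 ?addn0 // => c /(subsetP sub); rewrite inE => /andP[].
Qed.

Lemma has_circuit_superfluous E K X B : girth_bound #|X| -> 0 < #|X| <= #|K| ->
  edges_in E K X ->
  (forall e e', e.1 \in K -> e'.1 \in K -> e.1 != e'.1 -> ends E e != ends E e') ->
  #|X| < B -> 3 * #|X| + num_parallel E K < B + 2 * #|K| -> has_circuit E K B.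
Proof.
move=> bound /andP[X0 XK] EX simple XB.
have [n] := ubnP #|K|; elim: n E K XK EX simple => // n IH E K XK EX simple ltn le.
have [KX|KX] := eqVneq #|K| #|X|.
  by apply: has_circuit_mono (bound E K X erefl KX X0 EX) => //; lia.
have [p_le1|/card_gt1P [c1 [c2 []]]] := leqP (num_parallel E K) 1.
  apply: has_circuit_nonparallel bound X0 _ EX XB.
  by have := card_setId_predC K (parallel E); rewrite -/(num_parallel E K); lia.
rewrite !inE => /andP[c1K p1] /andP[c2K p2] c12.
have KK2 : K :\ c2 \subset K by apply: subsetDl.
have card_K2 : #|K| = #|K :\ c2|.+1 by rewrite (cardsD1 c2 K) c2K.
have p_lt := num_parallel_bundle c1K c2K c12 p1 p2 (simple (_, _) (_, _) c1K c2K c12).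
apply: (has_circuit_reindex (f := bundle c1 c2) (K' := K :\ c2)).
- by move=> e /(subsetP KK2); apply: bundle_in.
- exact: bundle_inj.
apply: IH.
- by move: XK KX card_K2; clear; lia.
- by move=> e /(subsetP KK2)/(bundle_in c1K c2K)/EX.
- move=> e e' eK e'K ne; apply: simple.
  + exact/bundle_in/(subsetP KK2).
  + exact/bundle_in/(subsetP KK2).
  + by apply: contraNneq ne => /(bundle_inj eK e'K) ->.
- by move: ltn card_K2; clear; lia.
- by move: le p_lt card_K2; clear; lia.
Qed.

End Bound.

Lemma leq_sum_subset (A : finType) (B B' : {pred A}) (F : A -> nat) :
  B \subset B' -> \sum_(x in B) F x <= \sum_(x in B') F x.
Proof.
move=> /subsetP sub.
by apply: (@sub_le_big _ addn leq leqnn (fun m n => leq_addr n m)) => x /sub.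
Qed.

Lemma card_setD1 (A : finType) (B : {set A}) x : x \in B -> #|B :\ x| = #|B|.-1.
Proof. by rewrite [in RHS](cardsD1 x B) => ->. Qed.

(** * Light circuits in graphs with two more edges than vertices *)

Section LightCircuits.
Variables T C : finType.
Implicit Types (E : C * bool -> T * T) (w : C -> nat) (K : {set C}) (X : {set T}).
Implicit Types (l : seq (step C)) (c : C) (v : T).

Definition weight w l := \sum_(s <- l) w (col s).

Definition light_circuit w E K :=
  exists2 l, circuit E K l & (weight w l).*2 <= \sum_(c in K) w c.

Lemma weight_subset w l l' :
  uniq l -> uniq l' -> {subset l <= l'} -> weight w l <= weight w l'.
Proof. exact: (@uniq_sub_le_big _ addn leq leqnn (fun m n => leq_addr n m)). Qed.

Lemma rainbow_weight w K l : rainbow K l -> weight w l <= \sum_(c in K) w c.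
Proof.
case/andP=> u /allP sub; rewrite /weight -(big_map (@col C) xpredT w) big_uniq //=.
exact/leq_sum_subset/subsetP.
Qed.

Lemma light_circuit_sub w E K K' :
  K \subset K' -> light_circuit w E K -> light_circuit w E K'.
Proof.
move=> KK' [l cl le]; exists l; first exact: circuit_sub cl.
by apply: leq_trans le _; apply: leq_sum_subset.
Qed.

Lemma light_circuit_disjoint w E K K' l l' : K' \subset K ->
  circuit E K' l -> circuit E (K :\: K') l' -> light_circuit w E K.
Proof.
move=> K'K cl cl'; have DK := subsetDl K K'.
have : weight w l + weight w l' <= \sum_(c in K) w c.
  rewrite (big_setID K') /= (setIidPr K'K) leq_add //; apply: rainbow_weight.
    by case/and3P: cl.
  by case/and3P: cl'.
have [le|lt] := leqP (weight w l) (weight w l') => sum_le.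
  by exists l; [apply: circuit_sub cl | lia].
by exists l'; [apply: circuit_sub cl' | lia].
Qed.

Lemma light_circuit_small w E K K' X l : edges_in E K X -> 0 < #|X| ->
  #|X| + 2 <= #|K| -> K' \subset K -> #|K'| <= 2 -> circuit E K' l ->
  light_circuit w E K.
Proof.
move=> EX X0 XK K'K K'2 cl.
have [||l' cl' _] := @exists_circuit _ _ E (K :\: K') X.
- exact: edges_in_sub (subsetDl _ _) EX.
- by rewrite X0 cardsD (setIidPr K'K); lia.
exact: light_circuit_disjoint K'K cl cl'.
Qed.

Lemma light_circuit_loop w E K X e : edges_in E K X -> 0 < #|X| ->
  #|X| + 2 <= #|K| -> e.1 \in K -> (E e).1 = (E e).2 -> light_circuit w E K.
Proof.
move=> EX X0 XK eK loop; have cl : circuit E [set e.1] [:: (e, false)].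
  by apply: circuit_loop; rewrite ?inE.
by apply: light_circuit_small EX X0 XK _ _ cl; rewrite ?sub1set ?cards1.
Qed.

Lemma light_circuit_digon w E K X e e' : edges_in E K X -> 0 < #|X| ->
  #|X| + 2 <= #|K| -> e.1 \in K -> e'.1 \in K -> e.1 != e'.1 ->
  ends E e = ends E e' -> light_circuit w E K.
Proof.
move=> EX X0 XK eK e'K ne /eqP/ends_eqP [o [src_eq tgt_eq]].
have cl : circuit E [set e.1; e'.1] [:: (e, false); flip (e', o)].
  apply: circuit_digon; rewrite ?src_flip ?tgt_flip //; first exact: set21.
  exact: set22.
apply: light_circuit_small EX X0 XK _ _ cl; rewrite ?cards2 ?ne //.
by rewrite subUset !sub1set eK.
Qed.

Definition merge_weight w c1 c2 c := if c == c1 then w c1 + w c2 else w c.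

Lemma merge_weight_le w c1 c2 c : w c <= merge_weight w c1 c2 c.
Proof. by rewrite /merge_weight; case: eqP => // ->; apply: leq_addr. Qed.

Lemma sum_merge_weight w K c1 c2 : c1 \in K -> c2 \in K -> c1 != c2 ->
  \sum_(c in K :\ c2) merge_weight w c1 c2 c = \sum_(c in K) w c.
Proof.
move=> c1K c2K c12; rewrite (big_setD1 c2 c2K).
have c1K' : c1 \in K :\ c2 by rewrite !inE c12.
rewrite !(big_setD1 c1 c1K') /= /merge_weight eqxx addnCA addnA; congr (_ + _).
by apply: eq_bigr => c /setD1P[/negbTE -> _].
Qed.

(* Contracting the edge [e2] to [q] suppresses the other end [v] of [e2], whose
   only other edge has colour [c1]. *)
Lemma light_circuit_suppress w E K c1 e2 v q :
  c1 \in K -> e2.1 \in K -> c1 != e2.1 -> ends E e2 = [set v; q] ->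
  (forall e, e.1 \in K -> v \in ends E e -> e.1 = c1 \/ e.1 = e2.1) ->
  light_circuit (merge_weight w c1 e2.1) (contracted E (ends E e2) q) (K :\ e2.1) ->
  light_circuit w E K.
Proof.
move=> c1K c2K c12 e2v deg_v [l cl]; rewrite sum_merge_weight // => le.
have KK : K :\ e2.1 \subset K by apply: subsetDl.
have rl : rainbow (K :\ e2.1) l by case/and3P: cl.
have [c1l|c1l] := boolP (c1 \in map (@col C) l); last first.
  exists l; last first.
    apply: leq_trans le; rewrite leq_double; apply: leq_sum => s _.
    exact: merge_weight_le.
  have same s : s \in l -> contracted E (ends E e2) q s.1 = E s.1.
    move=> sl; have /setD1P[sc2 sK] := rainbow_mem rl sl.
    have : v \notin ends E s.1.
      apply/negP => /(deg_v _ sK) [sc1|sc]; last by rewrite -sc eqxx in sc2.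
      by case/mapP: c1l; exists s.
    rewrite !inE negb_or !(eq_sym v) /contracted e2v => /andP[v1 v2].
    by rewrite !contract_set2 //; case: (E s.1).
  have same_link : {in l &, link E =2 link (contracted E (ends E e2) q)}.
    by move=> s s' sl s'l; rewrite /link /src /tgt !same.
  case/and3P: cl => n c r; rewrite /circuit n (rainbow_sub KK r) andbT.
  by rewrite (eq_in_cycle same_link (allss l)).
have disj : [disjoint K :\ e2.1 & [set e2.1]].
  by rewrite disjoint_sym disjoints1 !inE eqxx.
have qQ : q \in ends E e2 by rewrite e2v set22.
have diam : rainbow_diameter_le E [set e2.1] (ends E e2) 1.
  by apply: edge_diameter; rewrite inE.
have [l1 [l2 [cl' u1 sub r2 _]]] := uncontract_circuit qQ disj diam cl.
exists (l1 ++ l2); first by apply: circuit_sub cl'; rewrite subUset KK sub1set.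
apply: leq_trans le; rewrite leq_double [weight w _]big_cat /=.
have ul : uniq l by rewrite (map_uniq (f := @col C)) //; case/andP: rl.
have w1 : weight w l1 <= weight w l by apply: weight_subset.
have w2 : weight w l2 <= w e2.1 by have := rainbow_weight w r2; rewrite big_set1.
apply: leq_trans (leq_add w1 w2) _.
have /mapP [s sl ec1] := c1l.
rewrite /weight !(big_rem s sl) /= -ec1 /merge_weight eqxx addnAC leq_add2l.
by apply: leq_sum => s' _; apply: merge_weight_le.
Qed.

End LightCircuits.

Section Surplus.
Variables T C : finType.
Implicit Types (G : C -> T * T) (w : C -> nat) (K : {set C}) (X : {set T}).
Implicit Types (c : C) (v : T).

Definition single G (e : C * bool) : T * T := G e.1.

Definition star G K v := [set c in K | v \in ends (single G) (c, false)].

Lemma star_sub G K v : star G K v \subset K.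
Proof. by apply/subsetP => c /setIdP[]. Qed.

Lemma edges_in_remove G K X v : edges_in (single G) K X ->
  edges_in (single G) (K :\: star G K v) (X :\ v).
Proof.
move=> GX e /setDP[eK]; rewrite inE eK /= subsetD1 -/(ends (single G) e).
by rewrite GX.
Qed.

Lemma sum_star G w K X : edges_in (single G) K X ->
  (forall c, c \in K -> (G c).1 != (G c).2) ->
  \sum_(v in X) \sum_(c in star G K v) w c = (\sum_(c in K) w c).*2.
Proof.
move=> GX noloop; rewrite (exchange_big_dep (mem K)) => [|v c _ /setIdP[] //] /=.
rewrite -muln2 big_distrl; apply: eq_bigr => c cK; rewrite sum_nat_const mulnC /=.
congr (_ * _); rewrite -[RHS](_ : #|ends (single G) (c, false)| = 2).
  apply: eq_card => v; rewrite unfold_in /= !inE cK andb_idl // => vc.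
  by apply: (subsetP (GX (c, false) cK)); rewrite !inE.
by rewrite cards2 noloop.
Qed.

Lemma light_circuit_star G w K X v : edges_in (single G) K X ->
  0 < #|X :\ v| <= #|K :\: star G K v| ->
  \sum_(c in K) w c <= (\sum_(c in star G K v) w c).*2 ->
  light_circuit w (single G) K.
Proof.
move=> GX XK heavy; have [l cl _] := exists_circuit (edges_in_remove (v := v) GX) XK.
exists l; first exact: circuit_sub (subsetDl _ _) cl.
have := rainbow_weight w (_ : rainbow (K :\: star G K v) l).
case/and3P: cl => _ _ -> /(_ isT).
by move: heavy; rewrite (big_setID (star G K v)) /= (setIidPr (star_sub G K v)); lia.
Qed.

Section DegreeReduction.
Variables (G : C -> T * T) (w : C -> nat) (K : {set C}) (X : {set T}).
Hypotheses (GX : edges_in (single G) K X) (X_gt0 : 0 < #|X|) (cK : #|K| = #|X| + 2)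
  (noloop : forall c, c \in K -> (G c).1 != (G c).2)
  (IH : forall w' G' K' X', #|X'| < #|X| -> edges_in (single G') K' X' -> 0 < #|X'| ->
    #|X'| + 2 <= #|K'| -> light_circuit w' (single G') K').

Local Notation E := (single G).

Lemma other_neq v c : c \in K -> other_end (G c) v != v.
Proof.
by move/noloop; rewrite /other_end; have [->|//] := eqVneq (G c).1 v; rewrite eq_sym.
Qed.

Lemma card_X_gt1 : 1 < #|X|.
Proof.
have [c cK'] : exists c, c \in K by apply/card_gt0P; rewrite cK addn2.
by have := subset_leq_card (GX (e := (c, false)) cK'); rewrite cards2 noloop.
Qed.

Lemma light_circuit_deg_le1 v : v \in X -> #|star G K v| <= 1 -> light_circuit w E K.
Proof.
move=> vX deg_v; apply: light_circuit_sub (subsetDl K (star G K v)) _.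
apply: IH (edges_in_remove GX) _ _; rewrite ?card_setD1 //; first by lia.
  by have := card_X_gt1; lia.
by rewrite cardsD (setIidPr (star_sub G K v)); lia.
Qed.

Lemma light_circuit_deg2 v : v \in X -> #|star G K v| = 2 -> light_circuit w E K.
Proof.
move=> vX /eqP/cards2P [c1 [c2 [c12 star_v]]].
have [c1K _] : c1 \in K /\ v \in ends E (c1, false).
  by apply/andP; have := set21 c1 c2; rewrite -star_v inE.
have [c2K vc2] : c2 \in K /\ v \in ends E (c2, false).
  by apply/andP; have := set22 c1 c2; rewrite -star_v inE.
have ends_c2 := ends_other vc2; set q := other_end _ _ in ends_c2.
apply: (light_circuit_suppress c1K (e2 := (c2, false)) c2K c12 ends_c2).
  move=> e eK ve; apply/set2P; rewrite -star_v inE eK; exact: ve.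
have qQ : q \in ends E (c2, false) by rewrite ends_c2 set22.
have QX := GX (e := (c2, false)) c2K; have cX' := card_contracted qQ QX.
rewrite cards2 noloop //= in cX'.
pose G' c := contracted E (ends E (c2, false)) q (c, false).
apply: (@IH _ G' _ (q |: (X :\: ends E (c2, false)))).
- by lia.
- by apply: edges_in_sub (subD1set _ _) _; apply: (contracted_in qQ QX GX).
- by apply/card_gt0P; exists q; apply: setU11.
- by have := cardsD1 c2 K; rewrite c2K /=; lia.
Qed.

Lemma light_circuit_deg_ge v : v \in X -> #|X| <= #|star G K v| -> light_circuit w E K.
Proof.
move=> vX deg_v.
have [/dinjectiveP inj|/dinjectivePn [c cv [c' /andP[ne c'v] same]]] :=
    boolP (dinjectiveb (fun c => other_end (G c) v) (mem (star G K v))).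
  have sub : [set other_end (G c) v | c in star G K v] \subset X :\ v.
    apply/subsetP => _ /imsetP [c /setIdP[cK' vc] ->]; rewrite !inE other_neq //=.
    apply: (subsetP (GX (e := (c, false)) cK')); rewrite (ends_other vc); exact: set22.
  by have := subset_leq_card sub; rewrite card_in_imset // card_setD1 //; lia.
have [[cK' vc] [c'K vc']] := (setIdP cv, setIdP c'v).
apply: (@light_circuit_digon _ _ w E K X (c, false) (c', false)); rewrite ?cK //.
  by rewrite eq_sym.
by rewrite (ends_other vc) (ends_other vc') /= same.
Qed.

Lemma light_circuit_deg3 : (forall v, v \in X -> 2 < #|star G K v| < #|X|) ->
  light_circuit w E K.
Proof.
move=> deg; pose W := \sum_(c in K) w c; pose star_weight v := \sum_(c in star G K v) w c.
have X4 : #|X| = 4.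
  have [v /deg] := card_gt0P X_gt0.
  have : \sum_(v in X) 3 <= \sum_(v in X) \sum_(c in star G K v) 1.
    by apply: leq_sum => u /deg; rewrite sum1_card => /andP[].
  by rewrite (sum_star _ GX) // sum_nat_const sum1_card cK; lia.
have [/exists_inP [v vX heavy]|/exists_inPn light] :=
    boolP [exists v in X, W <= (star_weight v).*2].
  apply: light_circuit_star GX _ heavy.
  rewrite (cardsD K) (setIidPr (star_sub G K v)) cK card_setD1 // X4.
  by have := deg v vX; rewrite X4; lia.
have : \sum_(v in X) ((star_weight v).*2 + 1) <= \sum_(v in X) W.
  by apply: leq_sum => v /light; rewrite -ltnNge addn1.
rewrite big_split /= sum1_card sum_nat_const X4; under eq_bigr => v _ do rewrite -mul2n.
by rewrite -big_distrr /= (sum_star w GX noloop) -/W; lia.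
Qed.

End DegreeReduction.

Lemma surplus_light_circuit G w K X : edges_in (single G) K X -> 0 < #|X| ->
  #|X| + 2 <= #|K| -> light_circuit w (single G) K.
Proof.
have [n] := ubnP #|X|; elim: n G w K X => // n IHn G w K0 X ltn GX0 X0.
case/ex_subset_card => K KK0 cK; apply: (light_circuit_sub KK0).
have GX := edges_in_sub KK0 GX0; have XK : #|X| + 2 <= #|K| by rewrite cK.
have [/exists_inP [c cK' /eqP loop]|/exists_inPn noloop] :=
    boolP [exists c in K, (G c).1 == (G c).2].
  exact: (light_circuit_loop w (e := (c, false)) GX X0 XK).
have IH w' G' K' X' (lt : #|X'| < #|X|) := IHn G' w' K' X' (leq_trans lt ltn).
have [/exists_inP [v vX deg_v]|/exists_inPn deg_ge2] :=
    boolP [exists v in X, #|star G K v| <= 1].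
  by apply: light_circuit_deg_le1 vX deg_v.
have [/exists_inP [v vX /eqP deg_v]|/exists_inPn deg_neq2] :=
    boolP [exists v in X, #|star G K v| == 2].
  by apply: light_circuit_deg2 vX deg_v.
have [/exists_inP [v vX deg_v]|/exists_inPn deg_lt] :=
    boolP [exists v in X, #|X| <= #|star G K v|].
  by apply: light_circuit_deg_ge vX deg_v.
apply: (light_circuit_deg3 w GX) => // v vX.
by have := deg_ge2 v vX; have := deg_neq2 v vX; have := deg_lt v vX; lia.
Qed.

Lemma surplus_has_circuit G K X : edges_in (single G) K X -> 0 < #|X| ->
  #|X| + 2 <= #|K| -> has_circuit (single G) K #|K|.
Proof.
move=> GX X0 XK; have [l cl] := surplus_light_circuit (fun=> 1) GX X0 XK.
by rewrite /weight !sum1_size sum1_card; exists l.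
Qed.

End Surplus.

(** * Deleting vertices *)

Lemma card_setId_sum (A : finType) (B : {set A}) (P : pred A) :
  #|[set x in B | P x]| = \sum_(x in B) (P x : nat).
Proof.
rewrite -sum1_card big_mkcond [RHS]big_mkcond; apply: eq_bigr => x _.
by rewrite inE; case: (x \in B); case: (P x).
Qed.

Section Counting.
Variables T C : finType.
Variables (E : C * bool -> T * T) (K : {set C}).
Implicit Types (e : C * bool) (c : C) (v w : T) (S : {set T}).

Definition edge_count (P : pred (C * bool)) := #|[set e | (e.1 \in K) && P e]|.

Lemma edge_countE (P : pred (C * bool)) :
  edge_count P = \sum_(c in K) (P (c, false) + P (c, true)).
Proof.
under eq_bigr => c _ do rewrite addnC -(big_bool _ (fun b => P (c, b) : nat)).
rewrite pair_big /= /edge_count -sum1_card [LHS]big_mkcond [RHS]big_mkcond.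
apply: eq_bigr => -[c b] _.
by rewrite inE /= andbT; case: (c \in K); case: (P (c, b)).
Qed.

Definition sibling e : C * bool := (e.1, ~~ e.2).

Definition touched S e := ((E e).1 \in S) || ((E e).2 \in S).
Definition dead S c := touched S (c, false) && touched S (c, true).
Definition half_dead S c := touched S (c, false) (+) touched S (c, true).
Definition cherry v c := (v \in ends E (c, false)) && (v \in ends E (c, true)).

Definition degree v := edge_count (fun e => v \in ends E e).
Definition num_touched S := edge_count (touched S).
Definition num_dead S := #|[set c in K | dead S c]|.
Definition num_half_dead S := #|[set c in K | half_dead S c]|.
Definition num_links S w := edge_count (fun e => (w \in ends E e) && touched S e).
Definition num_fresh S w := #|[set c in K | dead (w |: S) c && ~~ dead S c]|.

Lemma siblingK : involutive sibling.
Proof. by case=> c b; rewrite /sibling negbK. Qed.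

Lemma touchedP S e : reflect (exists2 v, v \in S & v \in ends E e) (touched S e).
Proof.
apply: (iffP orP) => [[] eS|[v vS /set2P[] <-]]; try by auto.
- by exists (E e).1; rewrite // set21.
- by exists (E e).2; rewrite // set22.
Qed.

Lemma touchedU1 w S e : touched (w |: S) e = (w \in ends E e) || touched S e.
Proof.
rewrite /touched !inE !(eq_sym w).
by case: (_ == w); case: (_ == w); case: (_ \in S).
Qed.

Lemma touched1 v e : touched [set v] e = (v \in ends E e).
Proof. by rewrite /touched !inE !(eq_sym v). Qed.

Lemma dead_edge S e : dead S e.1 = touched S e && touched S (sibling e).
Proof. by case: e => c []; rewrite /dead //= andbC. Qed.

Lemma half_edge S e : half_dead S e.1 = touched S e (+) touched S (sibling e).
Proof. by case: e => c []; rewrite /half_dead //= addbC. Qed.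

Lemma cherry_edge v e : cherry v e.1 = (v \in ends E e) && (v \in ends E (sibling e)).
Proof. by case: e => c []; rewrite /cherry //= andbC. Qed.

Lemma num_touched1 v : num_touched [set v] = degree v.
Proof. by apply: eq_card => e; rewrite !inE /= touched1 !inE. Qed.

Lemma num_touchedE S : num_touched S = (num_dead S).*2 + num_half_dead S.
Proof.
rewrite /num_touched edge_countE /num_dead /num_half_dead !card_setId_sum.
rewrite -addnn -!big_split.
apply: eq_bigr => c _ /=.
by rewrite /dead /half_dead; case: (touched S (c, false)); case: (touched S (c, true)).
Qed.

Lemma num_touchedU1 S w : num_touched (w |: S) + num_links S w = num_touched S + degree w.
Proof.
rewrite /num_touched /num_links /degree !edge_countE -!big_split.
apply: eq_bigr => c _ /=; rewrite !touchedU1.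
by case: (w \in ends E (c, false)); case: (w \in ends E (c, true));
   case: (touched S (c, false)); case: (touched S (c, true)).
Qed.

Lemma num_deadU1 S w : num_dead (w |: S) = num_dead S + num_fresh S w.
Proof.
rewrite /num_dead /num_fresh !card_setId_sum -big_split.
apply: eq_bigr => c _ /=; rewrite /dead !touchedU1.
by case: (w \in ends E (c, false)); case: (w \in ends E (c, true));
   case: (touched S (c, false)); case: (touched S (c, true)).
Qed.

Lemma fresh_links_le S w : num_fresh S w + num_links S w <= degree w.
Proof.
rewrite /num_fresh /num_links /degree !edge_countE card_setId_sum -big_split.
apply: leq_sum => c _ /=; rewrite /dead !touchedU1.
by case: (w \in ends E (c, false)); case: (w \in ends E (c, true));
   case: (touched S (c, false)); case: (touched S (c, true)).
Qed.

Lemma num_links_gt0 S w :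
  reflect (exists e, [/\ e.1 \in K, w \in ends E e & touched S e]) (0 < num_links S w).
Proof.
apply: (iffP card_gt0P) => [[e]|[e [eK we te]]].
  by rewrite inE => /and3P[eK we te]; exists e.
by exists e; rewrite inE eK we.
Qed.

Lemma num_links_lt S w z e : e.1 \in K -> w \in ends E e -> z \in ends E e ->
  ~~ touched S e -> num_links S z < num_links (w |: S) z.
Proof.
move=> eK we ze untouched_e; apply/proper_card/properP; split.
  by apply/subsetP => e'; rewrite !inE touchedU1 => /and3P[-> -> ->]; rewrite orbT.
by exists e; rewrite inE eK ze ?touchedU1 ?we // (negbTE untouched_e).
Qed.

Lemma num_dead_lt S w z e : e.1 \in K -> w \in ends E e -> z \in ends E e ->
  ~~ touched S e -> touched S (sibling e) ->
  (forall e', e'.1 \in K -> w \in ends E e' -> z \in ends E (sibling e') ->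
    touched S e' || touched S (sibling e')) ->
  num_dead (z |: (w |: S)) + num_dead S < num_dead (w |: S) + num_dead (z |: S).
Proof.
move=> eK we ze untouched_e touched_sib no_bridge; rewrite -[X in _ < X]cardsUI -addnS.
apply: leq_add; [apply/subset_leq_card/subsetP => c | apply/proper_card/properP; split].
- rewrite !inE /dead !touchedU1 => /andP[cK]; rewrite cK /=.
  have := no_bridge (c, false) cK; have := no_bridge (c, true) cK; rewrite /sibling /=.
  case: (w \in ends E (c, false)); case: (w \in ends E (c, true));
    case: (z \in ends E (c, false)); case: (z \in ends E (c, true));
    case: (touched S (c, false)); case: (touched S (c, true)) => //= bridge_t bridge_f;
    by [move: (bridge_t isT isT) | move: (bridge_f isT isT)].
- apply/subsetP => c; rewrite !inE /dead !touchedU1 => /andP[-> /andP[-> ->]].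
  by rewrite !orbT.
exists e.1; rewrite !inE eK !dead_edge ?(negbTE untouched_e) //=.
by rewrite !touchedU1 we ze touched_sib !orbT.
Qed.

Definition alive S := [set c in K | ~~ dead S c].

(* A touched edge is replaced by its sibling. *)
Definition survivor S e : C * bool := (e.1, e.2 (+) touched S e).

Lemma card_alive S : num_dead S + #|alive S| = #|K|.
Proof. exact: card_setId_predC. Qed.

Lemma survivor_untouched S e : ~~ dead S e.1 -> ~~ touched S (survivor S e).
Proof.
case: e => c b; rewrite /dead /survivor /=.
by case: b; case t1: (touched S (c, false)); case t2: (touched S (c, true));
   rewrite /= ?t1 ?t2.
Qed.

Lemma survivor_in X S : edges_in E K X ->
  edges_in (E \o survivor S) (alive S) (X :\: S).
Proof.
move=> EX e /setIdP[eK /survivor_untouched/touchedP untouched]; apply/subsetP => v ve.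
rewrite inE (subsetP (EX (survivor S e) eK)) // andbT.
by apply: contra_notN untouched => vS; exists v.
Qed.

Lemma has_circuit_survivor S (K' : {set C}) B : K' \subset K ->
  has_circuit (E \o survivor S) K' B -> has_circuit E K B.
Proof.
move=> K'K c; apply: has_circuit_mono K'K (leqnn B) _.
exact: (has_circuit_select (b := fun e => e.2 (+) touched S e)).
Qed.

Lemma has_circuit_single_survivor S (K' : {set C}) B : K' \subset K ->
  has_circuit (single (fun c => E (survivor S (c, false)))) K' B -> has_circuit E K B.
Proof.
move=> K'K c; apply: has_circuit_mono K'K (leqnn B) _.
exact: (has_circuit_select (b := fun e => touched S (e.1, false))).
Qed.

End Counting.

(** * The even case without parallel colours *)

Section EvenCase.
Variables T C : finType.
Variables (E : C * bool -> T * T) (X : {set T}) (K : {set C}) (m : nat).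
Hypotheses (bound_lt : forall m', m' < m -> girth_bound T C m')
  (even_m : ~~ odd m) (m_gt0 : 0 < m) (card_X : #|X| = m) (card_K : #|K| = m)
  (EX : edges_in E K X) (no_parallel : forall c, c \in K -> ~~ parallel E c)
  (no_circuit : ~ has_circuit E K m.+1).
Implicit Types (c : C) (e : C * bool) (v w z : T) (S : {set T}).

Local Notation touched := (touched E).
Local Notation dead := (dead E).
Local Notation half_dead := (half_dead E).
Local Notation cherry := (cherry E).
Local Notation degree := (degree E K).
Local Notation num_touched := (num_touched E K).
Local Notation num_dead := (num_dead E K).
Local Notation num_half_dead := (num_half_dead E K).
Local Notation num_links := (num_links E K).
Local Notation num_fresh := (num_fresh E K).
Local Notation alive := (alive E K).

Lemma m_gt1 : 1 < m.
Proof. by move: even_m m_gt0; case: m => [|[]]. Qed.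

Lemma end_in e v : e.1 \in K -> v \in ends E e -> v \in X.
Proof. by move=> /EX /subsetP eX /eX. Qed.

Lemma no_loop e : e.1 \in K -> (E e).1 != (E e).2.
Proof.
move=> eK; apply/eqP => loop; apply: no_circuit.
by exists [:: (e, false)]; [apply: circuit_loop | rewrite ltnS ltnW // m_gt1].
Qed.

Lemma card_ends e : e.1 \in K -> #|ends E e| = 2.
Proof. by move=> eK; rewrite cards2 no_loop. Qed.

Lemma m_gt2 : 2 < m.
Proof.
rewrite ltn_neqAle m_gt1 andbT; apply/eqP => m2.
have [c cK] : exists c, c \in K by apply/card_gt0P; rewrite card_K.
have full b : ends E (c, b) = X.
  by apply: subset_card_eq; [apply: EX | rewrite card_ends // card_X -m2].
by have := no_parallel cK; rewrite /parallel !full eqxx.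
Qed.

Lemma ends_inj e e' : e.1 \in K -> e'.1 \in K -> ends E e = ends E e' -> e = e'.
Proof.
move=> eK e'K same; have [ec|ne] := eqVneq e.1 e'.1.
  case: e e' eK e'K ec same => [c b] [c' b'] /= cK _ <- same; congr pair.
  have := no_parallel cK; rewrite /parallel.
  by case: b b' same => [] [] // ->; rewrite eqxx.
have /ends_eqP [o [src_eq tgt_eq]] : ends E e == ends E e' by rewrite same.
case: no_circuit; exists [:: (e, false); flip (e', o)]; last by rewrite ltnS m_gt2.
by apply: circuit_digon; rewrite ?src_flip ?tgt_flip.
Qed.

Lemma edge_eq e e' v w : e.1 \in K -> e'.1 \in K -> v != w ->
  v \in ends E e -> w \in ends E e -> v \in ends E e' -> w \in ends E e' -> e = e'.
Proof.
move=> eK e'K vw ve we ve' we'; apply: ends_inj => //.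
have -> : ends E e = [set v; w] by apply: set2_eq; rewrite ?card_ends.
by apply/esym/set2_eq; rewrite ?card_ends.
Qed.

Lemma cherry_uniq c v w : c \in K -> cherry v c -> cherry w c -> v = w.
Proof.
move=> cK /andP[v1 v2] /andP[w1 w2]; apply/eqP/negPn/negP => vw.
by have [] := @edge_eq (c, false) (c, true) v w cK cK vw v1 w1 v2 w2.
Qed.

Lemma other_end_spec e v : e.1 \in K -> v \in ends E e ->
  [/\ other_end (E e) v \in X, other_end (E e) v \in ends E e & other_end (E e) v != v].
Proof.
move=> eK ve; have oe : other_end (E e) v \in ends E e by rewrite (ends_other ve) set22.
split=> //; first exact: end_in oe.
by have := card_ends eK; rewrite (ends_other ve) cards2 eq_sym; case: (_ != _).
Qed.

Lemma card_end_vertices e : e.1 \in K -> #|[set v in X | v \in ends E e]| = 2.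
Proof.
move=> eK; rewrite -(card_ends eK); apply: eq_card => v; rewrite inE andb_idl //.
exact: end_in.
Qed.

(* Otherwise the colours that lose one edge, bundled in pairs, would give a
   short circuit avoiding [S]. *)
Lemma card_lt_num_dead S : S \subset X -> 0 < #|S| < m -> num_touched S <= 3 * #|S| ->
  #|S| < num_dead S.
Proof.
move=> SX /andP[S0 Sm] few; rewrite ltnNge; apply/negP => dS; apply: no_circuit.
have cXS : #|X :\: S| = m - #|S| by rewrite cardsD (setIidPr SX) card_X.
have cA := card_alive E K S; rewrite card_K in cA.
have AK : alive S \subset K by apply/subsetP => c /setIdP[].
apply: (has_circuit_survivor AK).
apply: (@has_circuit_superfluous _ _ _ _ (X :\: S)).
- by apply: bound_lt; lia.
- by lia.
- exact: survivor_in.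
- move=> e e' /(subsetP AK) eK /(subsetP AK) e'K; apply: contraNneq => same.
  by have [-> _] := ends_inj (e := survivor E S e) (e' := survivor E S e') eK e'K same.
- by lia.
have : num_parallel (E \o survivor E S) (alive S) <= num_half_dead S.
  apply/subset_leq_card/subsetP => c.
  rewrite !inE -andbA => /and3P[cK alive_c]; rewrite cK; apply: contraLR => nhalf.
  move: alive_c nhalf (no_parallel cK).
  rewrite /dead /half_dead /parallel /ends /survivor /=.
  by case: (touched S (c, false)); case: (touched S (c, true)).
by move: few; rewrite num_touchedE cXS; lia.
Qed.

Lemma num_deadX : num_dead X = m.
Proof.
rewrite -card_K; apply: eq_card => c; rewrite inE andb_idr // => cK.
have touchedX b : touched X (c, b).
  by apply/touchedP; exists (E (c, b)).1; rewrite ?set21 // (end_in (e := (c, b))) ?set21.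
by rewrite /dead !touchedX.
Qed.

Lemma num_deadD1 v : num_dead (X :\ v) = m.
Proof.
rewrite -card_K; apply: eq_card => c; rewrite inE andb_idr // => cK.
suff touchedD1 b : touched (X :\ v) (c, b) by rewrite /dead !touchedD1.
apply/touchedP; have [ve|ve] := boolP (v \in ends E (c, b)).
  have [oX oe ov] := other_end_spec (e := (c, b)) cK ve.
  by exists (other_end (E (c, b)) v); rewrite // !inE ov.
exists (E (c, b)).1; rewrite ?set21 // !inE (end_in (e := (c, b))) ?set21 // andbT.
by apply: contraNneq ve => <-; rewrite set21.
Qed.

Lemma card_lt_m S : S \subset X -> num_dead S < m -> #|S| < m.
Proof.
move=> SX dS; rewrite -card_X ltn_neqAle subset_leq_card // andbT.
apply: contraTneq dS => cS; rewrite (subset_card_eq SX) ?cS //.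
by rewrite num_deadX ltnn.
Qed.

Lemma card_le_num_dead S : S \subset X -> #|S| <= (num_dead S).+1.
Proof.
move=> SX; rewrite leqNgt; apply/negP => dS; apply: no_circuit.
have Sm : #|S| <= m by rewrite -card_X subset_leq_card.
have {}Sm : #|S| < m by apply: card_lt_m => //; lia.
have cXS : #|X :\: S| = m - #|S| by rewrite cardsD (setIidPr SX) card_X.
have cA := card_alive E K S; rewrite card_K in cA.
have AK : alive S \subset K by apply/subsetP => c /setIdP[].
apply: (has_circuit_single_survivor AK).
apply: has_circuit_mono (surplus_has_circuit (X := X :\: S) _ _ _); rewrite ?cXS //.
- by move: cA; clear; lia.
- by move=> e eA; apply: (survivor_in EX (e := (e.1, false))).
- by move: Sm; clear; lia.
- by move: cA Sm dS; clear; lia.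
Qed.

Lemma sum_ends e : e.1 \in K -> \sum_(v in X) (v \in ends E e : nat) = 2.
Proof. by move=> eK; rewrite -card_setId_sum card_end_vertices. Qed.

Lemma sum_degree : \sum_(v in X) degree v = 4 * m.
Proof.
under eq_bigr => v _ do rewrite [degree v]edge_countE.
rewrite exchange_big /= mulnC -card_K -sum_nat_const; apply: eq_bigr => c cK.
by rewrite big_split /= !sum_ends.
Qed.

Lemma regular v : v \in X -> degree v = 4.
Proof.
have ge4 u : u \in X -> 4 <= degree u.
  move=> uX; rewrite leqNgt; apply/negP; rewrite -num_touched1 => deg_u.
  have := @card_lt_num_dead [set u]; rewrite sub1set cards1 m_gt1 => /(_ uX isT deg_u).
  by move: deg_u; rewrite num_touchedE; lia.
move=> vX; apply/eqP; rewrite eqn_leq ge4 // andbT leqNgt; apply/negP => gt4.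
have := sum_degree; rewrite (big_setD1 v vX) /=.
have : \sum_(u in X :\ v) 4 <= \sum_(u in X :\ v) degree u.
  by apply: leq_sum => u /setD1P[_]; apply: ge4.
by rewrite sum_nat_const; have := cardsD1 v X; rewrite vX card_X; lia.
Qed.

Lemma sum_links S : S \subset X ->
  \sum_(w in X :\: S) num_links S w + 4 * #|S| = (num_touched S).*2.
Proof.
move=> SX; have sumX : \sum_(w in X) num_links S w = (num_touched S).*2.
  under eq_bigr => w _ do rewrite [num_links S w]edge_countE.
  rewrite /num_touched edge_countE exchange_big /= -muln2 big_distrl.
  have sum_edge e : e.1 \in K ->
      \sum_(w in X) ((w \in ends E e) && touched S e : nat) = touched S e * 2.
    move=> eK; case: (touched S e); last by rewrite big1 // => w _; rewrite andbF.
    by under eq_bigr => w _ do rewrite andbT; rewrite sum_ends.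
  by apply: eq_bigr => c cK; rewrite big_split /= !sum_edge ?mulnDl.
have sumS : \sum_(w in S) num_links S w = 4 * #|S|.
  rewrite mulnC -sum_nat_const; apply: eq_bigr => w wS.
  rewrite -(regular (subsetP SX w wS)); apply: eq_card => e.
  rewrite [LHS]inE [RHS]inE /=; congr (_ && _).
  by rewrite andb_idr // => we; apply/touchedP; exists w.
by rewrite -sumX -sumS [RHS](big_setID S) /= (setIidPr SX) addnC.
Qed.

Lemma sum_fresh S : S \subset X ->
  \sum_(w in X :\: S) num_fresh S w + num_dead S <= m + num_half_dead S.
Proof.
move=> SX; under eq_bigr => w _ do rewrite [num_fresh S w]card_setId_sum.
rewrite /num_dead /num_half_dead !card_setId_sum exchange_big /=.
rewrite -{1}card_K -sum1_card -!big_split.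
apply: leq_sum => c cK /=; under eq_bigr => w _ do rewrite /dead !touchedU1.
have sum_le2 b : \sum_(w in X :\: S) (w \in ends E (c, b) : nat) <= 2.
  by rewrite -(@sum_ends (c, b)) // leq_sum_subset ?subsetDl.
rewrite /dead /half_dead.
case: (touched S (c, false)); case: (touched S (c, true)) => /=.
- by rewrite big1 // => w _; rewrite !orbT.
- rewrite addn0; apply: leq_trans (sum_le2 true); apply: leq_sum => w _.
  by rewrite orbT orbF andbT.
- rewrite addn0; apply: leq_trans (sum_le2 false); apply: leq_sum => w _.
  by rewrite orbT orbF !andbT.
rewrite !addn0 -card_setId_sum; apply/card_le1_eqP => w w'.
move=> /setIdP[_ cw] /setIdP[_ cw']; move: cw cw'; rewrite !orbF !andbT.
by move=> cw cw'; apply: cherry_uniq cK cw' cw.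
Qed.

Section EveryVertexACentre.
Variable ctr : T -> C.
Hypothesis ctrP : forall v, v \in X -> ctr v \in K /\ cherry v (ctr v).

Lemma mem_ctr v b : v \in X -> v \in ends E (ctr v, b).
Proof. by case/ctrP => _ /andP[vf vt]; case: b. Qed.

Lemma ctr_inj : {in X &, injective ctr}.
Proof.
move=> v w vX wX same; have [ctrK cherry_v] := ctrP vX.
by apply: cherry_uniq cherry_v _ => //; rewrite same; have [] := ctrP wX.
Qed.

Lemma ctr_inj_in S : S \subset X -> {in S &, injective ctr}.
Proof. by move=> /subsetP SX v w /SX vX /SX; apply: ctr_inj. Qed.

Lemma ctr_onto c : c \in K -> exists2 v, v \in X & c = ctr v.
Proof.
suff -> : K = ctr @: X by move/imsetP.
apply/esym/subset_card_eq.
  by apply/subsetP => _ /imsetP [v /ctrP [ctrK _] ->].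
by rewrite (card_in_imset ctr_inj) card_X card_K.
Qed.

Lemma cherry_ctr v c : c \in K -> cherry v c -> c = ctr v.
Proof.
move=> cK cherry_v; have [w wX ec] := ctr_onto cK; rewrite ec; congr ctr.
by apply: cherry_uniq cK _ cherry_v; rewrite ec; have [] := ctrP wX.
Qed.

Lemma dead_ctr S v : S \subset X -> v \in S -> dead S (ctr v).
Proof.
move=> SX vS; have vX := subsetP SX v vS.
by apply/andP; split; apply/touchedP; exists v => //; apply: mem_ctr.
Qed.

Lemma ctr_dead S : S \subset X -> ctr @: S \subset [set c in K | dead S c].
Proof.
move=> SX; apply/subsetP => _ /imsetP [v vS ->]; rewrite inE dead_ctr // andbT.
by have [] := ctrP (subsetP SX v vS).
Qed.

Lemma card_le_num_dead_ctr S : S \subset X -> #|S| <= num_dead S.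
Proof.
by move=> SX; rewrite -(card_in_imset (ctr_inj_in SX)) subset_leq_card // ctr_dead.
Qed.

Lemma num_dead_single v : v \in X -> num_dead [set v] = 1.
Proof.
move=> vX; rewrite -(cards1 (ctr v)); apply: eq_card => c; rewrite !inE.
apply/andP/eqP => [[cK]|->]; last by have [? ?] := ctrP vX; rewrite /dead !touched1.
by rewrite /dead !touched1; apply: cherry_ctr.
Qed.

Definition tight S :=
  [&& S \subset X, 0 < #|S| < m, num_touched S <= (3 * #|S|).+1 & num_dead S <= #|S|].

Section MaximalTight.
Variable S : {set T}.
Hypotheses (tightS : tight S) (maxS : forall S', tight S' -> #|S'| <= #|S|).

Let SX : S \subset X. Proof. by case/and4P: tightS. Qed.
Let S_gt0 : 0 < #|S|. Proof. by case/and4P: tightS => _ /andP[]. Qed.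
Let S_lt_m : #|S| < m. Proof. by case/and4P: tightS => _ /andP[]. Qed.

Lemma tight_num_dead : num_dead S = #|S|.
Proof.
by apply/eqP; rewrite eqn_leq card_le_num_dead_ctr // andbT; case/and4P: tightS.
Qed.

Lemma tight_num_touched : num_touched S = (3 * #|S|).+1.
Proof.
apply/eqP; rewrite eqn_leq; case/and4P: tightS => _ _ -> _ /=; rewrite ltnNge.
apply/negP => few; have := card_lt_num_dead SX; rewrite S_gt0 S_lt_m => /(_ isT few).
by rewrite tight_num_dead ltnn.
Qed.

Lemma tight_num_half : num_half_dead S = #|S|.+1.
Proof.
by have := num_touchedE E K S; rewrite tight_num_touched tight_num_dead; lia.
Qed.

Definition half_centres := [set g in X | half_dead S (ctr g)].

Let half_X : half_centres \subset X.
Proof. by apply/subsetP => g /setIdP[]. Qed.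

Lemma ctr_half_centres : ctr @: half_centres = [set c in K | half_dead S c].
Proof.
apply/setP => c; rewrite inE.
apply/imsetP/andP => [[g /setIdP[gX half_g] ->]|[cK half_c]].
  by have [] := ctrP gX.
by have [g gX ec] := ctr_onto cK; exists g; rewrite // inE gX -ec.
Qed.

Lemma card_half_centres : #|half_centres| = #|S|.+1.
Proof.
by rewrite -(card_in_imset (ctr_inj_in half_X)) ctr_half_centres -tight_num_half.
Qed.

Lemma half_centre_notin g : g \in half_centres -> g \notin S.
Proof.
case/setIdP => gX; apply: contraL => gS; have := dead_ctr SX gS.
by rewrite /dead /half_dead => /andP[-> ->].
Qed.

Lemma half_centre_fresh g : g \in half_centres -> 1 < num_fresh S g.
Proof.
move=> gP; have /setIdP[gX half_g] := gP; have gS := half_centre_notin gP.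
have links_g : 0 < num_links S g.
  have [ctrK _] := ctrP gX; apply/num_links_gt0.
  move: half_g; rewrite /half_dead; case tf: (touched S (ctr g, false)) => /= tt.
    by exists (ctr g, false); rewrite mem_ctr.
  by exists (ctr g, true); rewrite mem_ctr.
have cgS : #|g |: S| = #|S|.+1 by rewrite cardsU1 gS.
have Sg_lt_m : #|S|.+1 < m.
  rewrite ltn_neqAle S_lt_m andbT; apply/eqP => cS; have := tight_num_dead.
  rewrite (_ : S = X :\ g) ?num_deadD1; last first.
    apply: subset_card_eq; first by rewrite subsetD1 SX.
    by have := cardsD1 g X; rewrite gX card_X; move: S_lt_m cS; clear; lia.
  by have := cardsD1 g X; rewrite gX card_X; move: S_lt_m cS; clear; lia.
rewrite ltnNge; apply/negP => few; have : tight (g |: S).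
  rewrite /tight subUset sub1set gX SX cgS Sg_lt_m num_deadU1 tight_num_dead /=.
  have := num_touchedU1 E K S g; rewrite regular // tight_num_touched.
  by move: links_g few; clear; lia.
by move/maxS; rewrite cgS ltnn.
Qed.

Definition outer_edge g := survivor E S (ctr g, false).

Lemma half_centre_outer_end g : g \in half_centres ->
  exists2 h, h \in half_centres & other_end (E (outer_edge h)) h = g.
Proof.
move=> gP; have /setIdP[gX _] := gP; have := half_centre_fresh gP.
case/card_gt1P => c' [c'' [c'F c''F ne]].
have [c [cK ncg fresh_c alive_c]] :
    exists c, [/\ c \in K, c != ctr g, dead (g |: S) c & ~~ dead S c].
  have [ec'|ne'] := eqVneq c' (ctr g); [exists c'' | exists c'].
    by move: c''F; rewrite inE -ec' eq_sym ne => /and3P[].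
  by move: c'F; rewrite inE => /and3P[].
have [h hX ec] := ctr_onto cK; set f := outer_edge h.
have fc : f.1 = c by rewrite ec.
have untouched_f : ~~ touched S f by apply: survivor_untouched; rewrite -ec.
have gf : g \in ends E f.
  by move: fresh_c; rewrite -fc dead_edge !touchedU1 (negbTE untouched_f) orbF => /andP[].
have touched_sib : touched S (sibling f).
  move: fresh_c; rewrite -fc dead_edge !touchedU1 => /andP[_ /orP[gsf|//]].
  by case/eqP: ncg; apply: cherry_ctr; rewrite // -fc cherry_edge gf.
have gh : g != h by apply: contraNneq ncg => ->; rewrite ec.
exists h; first by rewrite inE hX -ec -fc half_edge (negbTE untouched_f).
by move: gf; rewrite (ends_other (mem_ctr _ hX)) !inE (negbTE gh) => /eqP.
Qed.

Lemma outer_edge_in g : g \in half_centres -> ends E (outer_edge g) \subset half_centres.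
Proof.
move=> gP; pose head h := other_end (E (outer_edge h)) h.
have gX : g \in X by case/setIdP: gP.
have head_onto : half_centres = head @: half_centres.
  apply: subset_card_eq; last exact: leq_imset_card.
  by apply/subsetP => h /half_centre_outer_end [h' h'P <-]; apply: imset_f.
rewrite (ends_other (mem_ctr _ gX)) subUset !sub1set gP /= head_onto.
exact: imset_f.
Qed.

Lemma maximal_tight_absurd : False.
Proof.
have cP := card_half_centres; have PK : ctr @: half_centres \subset K.
  by rewrite ctr_half_centres; apply/subsetP => c /setIdP[].
have cPK : #|ctr @: half_centres| = #|half_centres|.
  by rewrite (card_in_imset (ctr_inj_in half_X)).
have disj : S \subset X :\: half_centres.
  rewrite subsetD SX disjoint_sym disjoints_subset.
  by apply/subsetP => g /half_centre_notin; rewrite inE.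
have P2 : #|half_centres|.*2 <= m.
  have := subset_leq_card disj; rewrite cardsD (setIidPr half_X) card_X cP.
  by move: even_m; lia.
apply: no_circuit; apply: (has_circuit_single_survivor (S := S) PK).
pose G c := E (survivor E S (c, false)).
have in_P : edges_in (single G) (ctr @: half_centres) half_centres.
  by move=> [c b] /imsetP [g gP /= ->]; apply: outer_edge_in.
apply: has_circuit_mono (exists_circuit in_P _); rewrite ?cPK ?cP ?leqnn //.
by rewrite -cP leqW.
Qed.

End MaximalTight.

Lemma all_centres_absurd : False.
Proof.
have [v vX] : exists v, v \in X by apply/card_gt0P; rewrite card_X.
have tight_v : tight [set v].
  by rewrite /tight sub1set vX cards1 m_gt1 num_touched1 regular // num_dead_single.
by case: (arg_maxnP (fun S : {set T} => #|S|) tight_v) => S; apply: maximal_tight_absurd.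
Qed.

End EveryVertexACentre.

Lemma m_gt4 : 4 < m.
Proof.
have [v vX] : exists v, v \in X by apply/card_gt0P; rewrite card_X.
pose at_v := [set e : C * bool | (e.1 \in K) && (v \in ends E e)].
have card_at_v : #|at_v| = 4 by apply: regular.
have other_inj : {in at_v &, injective (fun e => other_end (E e) v)}.
  move=> e e' /setIdP[eK ve] /setIdP[e'K ve'] /= same; apply: ends_inj => //.
  by rewrite (ends_other ve) (ends_other ve') same.
have sub : [set other_end (E e) v | e in at_v] \subset X :\ v.
  apply/subsetP => _ /imsetP [e /setIdP[eK ve] ->].
  by have [oX _ ov] := other_end_spec eK ve; rewrite !inE ov.
have := subset_leq_card sub; rewrite card_in_imset // card_at_v.
by have := cardsD1 v X; rewrite vX card_X; lia.
Qed.

Lemma no_triangle e1 e2 e3 u v w : {subset [:: e1.1; e2.1; e3.1] <= K} ->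
  uniq [:: e1.1; e2.1; e3.1] -> ends E e1 = [set u; v] -> ends E e2 = [set v; w] ->
  ends E e3 = [set w; u] -> False.
Proof.
move=> sub u123 /step_of_ends [o1 [s1 t1]] /step_of_ends [o2 [s2 t2]].
move=> /step_of_ends [o3 [s3 t3]].
apply: no_circuit; exists [:: (e1, o1); (e2, o2); (e3, o3)]; last exact: m_gt4.
apply: circuit_triangle; rewrite ?t1 ?t2 ?t3 //.
by rewrite /rainbow u123; apply/allP.
Qed.

Definition sparse S :=
  [&& S \subset X, num_touched S <= (3 * #|S|).+1 & num_dead S < #|S|].

Section MaximalSparse.
Variable S : {set T}.
Hypotheses (sparseS : sparse S) (maxS : forall S', sparse S' -> #|S'| <= #|S|).

Lemma sparse_sub : S \subset X. Proof. by case/and3P: sparseS. Qed.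
Let SX := sparse_sub.

Lemma sparse_num_dead : (num_dead S).+1 = #|S|.
Proof. by apply/eqP; rewrite eqn_leq card_le_num_dead // andbT; case/and3P: sparseS. Qed.

Lemma sparse_lt_m : #|S| < m.
Proof.
apply: card_lt_m; rewrite // -card_X; apply: leq_trans (subset_leq_card SX).
by case/and3P: sparseS.
Qed.

Lemma sparse_num_touched : num_touched S = (3 * #|S|).+1.
Proof.
apply/eqP; rewrite eqn_leq; case/and3P: sparseS => _ -> lt /=; rewrite ltnNge.
apply/negP => few; have := card_lt_num_dead SX; rewrite sparse_lt_m andbT.
by move=> /(_ (leq_ltn_trans (leq0n _) lt) few); rewrite ltnNge (ltnW lt).
Qed.

Lemma sparse_num_half : num_half_dead S = #|S| + 3.
Proof.
have := num_touchedE E K S; rewrite sparse_num_touched.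
by have := sparse_num_dead; lia.
Qed.

Section Outside.
Variable w : T.
Hypothesis wXS : w \in X :\: S.

Let wX : w \in X. Proof. by case/setDP: wXS. Qed.
Let card_U1 : #|w |: S| = #|S|.+1.
Proof. by rewrite cardsU1; case/setDP: wXS => _ ->. Qed.

Let sub_U1 : w |: S \subset X.
Proof. by rewrite subUset sub1set wX. Qed.

Lemma fresh_gt0 : 0 < num_fresh S w.
Proof.
have := card_le_num_dead sub_U1; rewrite card_U1 num_deadU1.
by have := sparse_num_dead; lia.
Qed.

Lemma fresh_gt1 : 0 < num_links S w -> 1 < num_fresh S w.
Proof.
move=> links_w; rewrite ltnNge; apply/negP => few.
suff /maxS : sparse (w |: S) by rewrite card_U1 ltnn.
rewrite /sparse sub_U1 card_U1 num_deadU1 ltnS /=; have := sparse_num_dead.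
by have := num_touchedU1 E K S w; rewrite sparse_num_touched regular //; lia.
Qed.

Lemma links_le1 : num_links S w <= 1.
Proof.
rewrite leqNgt; apply/negP => links_w.
have dead_U1 : #|w |: S| < num_dead (w |: S) -> False.
  have := fresh_links_le E K S w; rewrite regular // card_U1 num_deadU1.
  by have := sparse_num_dead; lia.
have [U1_lt_m|/(conj sparse_lt_m) U1_m] := ltnP #|w |: S| m.
  apply/dead_U1/card_lt_num_dead => //; first by rewrite U1_lt_m card_U1.
  by have := num_touchedU1 E K S w; rewrite card_U1 sparse_num_touched regular //; lia.
have := sparse_num_dead; rewrite (_ : S = X :\ w) ?num_deadD1; last first.
  apply: subset_card_eq; first by rewrite subsetD1 SX; case/setDP: wXS.
  by have := cardsD1 w X; rewrite wX card_X card_U1 in U1_m *; lia.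
by have := cardsD1 w X; rewrite wX card_X; lia.
Qed.

Lemma links_lt_fresh : num_links S w < num_fresh S w.
Proof. by have := links_le1; have := fresh_gt0; have := fresh_gt1; lia. Qed.

End Outside.

Definition excess w := num_fresh S w - (num_links S w).+1.

Lemma num_freshE w : w \in X :\: S -> num_fresh S w = excess w + (num_links S w).+1.
Proof. by move=> /links_lt_fresh lt; rewrite /excess subnK. Qed.

Lemma sum_excess : \sum_(w in X :\: S) excess w + #|S| <= 2.
Proof.
have := sum_fresh SX; rewrite (eq_bigr _ num_freshE) big_split /=.
under [X in _ + X + _]eq_bigr => w _ do rewrite -addn1.
rewrite big_split sum1_card /= cardsD (setIidPr SX) card_X sparse_num_half.
have := sum_links SX; rewrite sparse_num_touched.
by have := sparse_num_dead; have := sparse_lt_m; lia.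
Qed.

Definition loose :=
  [set e | (e.1 \in K) && (~~ touched S e && touched S (sibling e))].
Definition loose_at w := [set e in loose | w \in ends E e].
Definition untouched_at w :=
  [set e | (e.1 \in K) && ((w \in ends E e) && ~~ touched S e)].

Lemma looseP e :
  reflect [/\ e.1 \in K, ~~ touched S e & touched S (sibling e)] (e \in loose).
Proof. by rewrite inE; apply: and3P. Qed.

Lemma loose_half e : e \in loose -> half_dead S e.1.
Proof. by case/looseP => _ /negbTE ut t; rewrite half_edge ut t. Qed.

Lemma loose_inj e e' : e \in loose -> e' \in loose -> e.1 = e'.1 -> e = e'.
Proof.
case: e e' => [c b] [c' b'] /looseP[_ ut t] /looseP[_ ut' t'] /= ec; subst c'; congr pair.
by move: ut t ut' t'; rewrite /sibling /=; case: b; case: b' => //= /negbTE ->.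
Qed.

Lemma card_loose : #|loose| = num_half_dead S.
Proof.
rewrite -/(edge_count K (fun e => ~~ touched S e && touched S (sibling e))) edge_countE.
rewrite /num_half_dead card_setId_sum; apply: eq_bigr => c _.
rewrite /half_dead /sibling /=.
by case: (touched S (c, false)); case: (touched S (c, true)).
Qed.

Lemma card_loose_at w : #|loose_at w| =
  edge_count K (fun e => [&& w \in ends E e, ~~ touched S e & touched S (sibling e)]).
Proof.
apply: eq_card => e; rewrite [LHS]inE [e \in loose]inE [RHS]inE -!andbA; congr (_ && _).
by rewrite andbA andbC.
Qed.

Lemma card_loose_at_le w : #|loose_at w| <= num_fresh S w.
Proof.
rewrite card_loose_at edge_countE /num_fresh card_setId_sum; apply: leq_sum => c _.
rewrite /dead !touchedU1 /sibling /=.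
by case: (w \in ends E (c, false)); case: (w \in ends E (c, true));
   case: (touched S (c, false)); case: (touched S (c, true)).
Qed.

Lemma card_untouched_at w : num_links S w + #|untouched_at w| = degree w.
Proof.
rewrite -/(edge_count K (fun e => (w \in ends E e) && ~~ touched S e)).
rewrite /num_links /degree !edge_countE -big_split; apply: eq_bigr => c _ /=.
by case: (w \in ends E (c, false)); case: (w \in ends E (c, true));
   case: (touched S (c, false)); case: (touched S (c, true)).
Qed.

Definition new_cherry_edge w e :=
  cherry w e.1 && ~~ (touched S e || touched S (sibling e)).
Definition new_cherry_at w := [set e | (e.1 \in K) && new_cherry_edge w e].

Lemma num_fresh_double w : (num_fresh S w).*2 = (#|loose_at w|).*2 + #|new_cherry_at w|.
Proof.
rewrite -/(edge_count K (new_cherry_edge w)) card_loose_at !edge_countE.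
rewrite /num_fresh card_setId_sum -!mul2n !big_distrr -big_split.
apply: eq_bigr => c _; rewrite /new_cherry_edge /cherry /dead !touchedU1 /sibling /=.
by case: (w \in ends E (c, false)); case: (w \in ends E (c, true));
   case: (touched S (c, false)); case: (touched S (c, true)).
Qed.

Definition critical w := [&& w \in X :\: S, num_links S w == 1 & excess w == 0].

Section Critical.
Variable w : T.
Hypothesis crit_w : critical w.

Let wXS : w \in X :\: S. Proof. by case/and3P: crit_w. Qed.
Let wX : w \in X. Proof. by case/setDP: wXS. Qed.

Lemma critical_fresh : num_fresh S w = 2.
Proof. by rewrite num_freshE //; case/and3P: crit_w => _ /eqP-> /eqP->. Qed.

Lemma critical_untouched : #|untouched_at w| = 3.
Proof.
by have := card_untouched_at w; rewrite regular //; case/and3P: crit_w => _ /eqP-> _ [].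
Qed.

Let loose_cherry_disjoint : [disjoint loose_at w & new_cherry_at w].
Proof.
apply/pred0P => e /=; apply/negP => /andP[/setIdP[/looseP[_ _ t] _]].
by rewrite inE /new_cherry_edge t orbT !andbF.
Qed.

Let loose_cherry_sub : loose_at w :|: new_cherry_at w \subset untouched_at w.
Proof.
apply/subsetP => e; rewrite inE => /orP[/setIdP[/looseP[eK ut _] we]|/setIdP[eK]].
  by rewrite inE eK we ut.
rewrite /new_cherry_edge cherry_edge negb_or => /andP[/andP[we _] /andP[ut _]].
by rewrite inE eK we ut.
Qed.

Let card_loose_cherry :
  #|loose_at w :|: new_cherry_at w| = #|loose_at w| + #|new_cherry_at w|.
Proof. by rewrite cardsU (disjoint_setI0 loose_cherry_disjoint) cards0 subn0. Qed.

Lemma critical_loose_gt0 : 0 < #|loose_at w|.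
Proof.
have := subset_leq_card loose_cherry_sub; rewrite card_loose_cherry critical_untouched.
by have := num_fresh_double w; rewrite critical_fresh; clear; lia.
Qed.

(* Two loose edges and a third untouched edge leave no room for a new cherry. *)
Lemma critical_third_edge e : e \in untouched_at w -> w \notin ends E (sibling e) ->
  ~~ touched S (sibling e) -> #|loose_at w| = 2 /\ untouched_at w = e |: loose_at w.
Proof.
move=> eU wse untouched_sib.
have e_new : e \notin loose_at w :|: new_cherry_at w.
  rewrite in_setU [_ \in new_cherry_at w]inE /new_cherry_edge cherry_edge (negbTE wse).
  rewrite !andbF orbF.
  by apply/negP => /setIdP[/looseP[_ _]]; rewrite (negbTE untouched_sib).
have sub : e |: (loose_at w :|: new_cherry_at w) \subset untouched_at w.
  by rewrite subUset sub1set eU.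
have := subset_leq_card sub; rewrite cardsU1 e_new card_loose_cherry critical_untouched.
have := num_fresh_double w; rewrite critical_fresh => double le.
have two : #|loose_at w| = 2 by move: double le; clear; lia.
split=> //; apply/esym/subset_card_eq.
  by apply: subset_trans sub; rewrite setUA subsetUl.
by rewrite cardsU1 (contra (subsetP (subsetUl _ _) e) e_new) two critical_untouched.
Qed.

End Critical.

Lemma card_S_le2 : #|S| <= 2.
Proof. by have := sum_excess; lia. Qed.

(* Otherwise [S] could be enlarged by both [w] and [z]. *)
Lemma critical_bridge w z e : critical w -> z \in X :\: S -> z != w -> excess z = 0 ->
  e \in loose_at w -> z \in ends E e -> exists e',
  [/\ e'.1 \in K, w \in ends E e', z \in ends E (sibling e'), ~~ touched S e' &
      ~~ touched S (sibling e')].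
Proof.
move=> crit_w zXS zw ez /setIdP[/looseP[eK untouched_e touched_sib] we] ze.
have /and3P[wXS /eqP links_w _] := crit_w.
have [[wX wS] [zX zS]] := (setDP wXS, setDP zXS).
have [/existsP [e' /and5P[]]|/existsPn no_bridge] := boolP [exists e' : C * bool,
    [&& e'.1 \in K, w \in ends E e', z \in ends E (sibling e'), ~~ touched S e' &
        ~~ touched S (sibling e')]]; first by exists e'.
exfalso; have {}no_bridge e' : e'.1 \in K -> w \in ends E e' ->
    z \in ends E (sibling e') -> touched S e' || touched S (sibling e').
  by move=> e'K we' ze'; have := no_bridge e'; rewrite e'K we' ze' /= -negb_or negbK.
set S2 := z |: (w |: S).
have S2X : S2 \subset X by rewrite !subUset !sub1set zX wX.
have card_S2 : #|S2| = #|S| + 2.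
  by rewrite !cardsU1 !inE negb_or zw zS wS /= !add1n addn2.
have dead_S2 : num_dead S2 <= #|S| + 1 + num_links S z.
  have := num_dead_lt eK we ze untouched_e touched_sib no_bridge.
  rewrite -/S2 !(num_deadU1 _ _ S) critical_fresh // num_freshE // ez -sparse_num_dead.
  by clear; lia.
have touched_S2 : num_touched S2 + num_links S z <= 3 * #|S| + 7.
  have := num_links_lt eK we ze untouched_e; have := num_touchedU1 E K (w |: S) z.
  have := num_touchedU1 E K S w; rewrite !regular // sparse_num_touched links_w -/S2.
  by clear; lia.
have links_z := links_le1 zXS.
have [links_z0|links_z1] := posnP (num_links S z).
  suff /maxS : sparse S2 by rewrite card_S2 addn2 ltnNge leqnSn.
  by rewrite /sparse S2X card_S2; move: dead_S2 touched_S2; rewrite links_z0; clear; lia.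
have := card_lt_num_dead S2X; rewrite card_S2.
have -> : 0 < #|S| + 2 < m by move: card_S_le2 m_gt4; clear; lia.
move=> /(_ isT); move: dead_S2 touched_S2 links_z links_z1; clear; lia.
Qed.

Lemma loose_other w e : e \in loose_at w ->
  [/\ other_end (E e) w \in X :\: S, other_end (E e) w != w &
      other_end (E e) w \in ends E e].
Proof.
case/setIdP => /looseP[eK untouched_e _] we; have [oX oe ow] := other_end_spec eK we.
split=> //; rewrite inE oX andbT; apply: contra untouched_e => oS.
by apply/touchedP; exists (other_end (E e) w).
Qed.

Lemma critical_bridge_other w e : critical w -> e \in loose_at w ->
  excess (other_end (E e) w) = 0 -> exists e', [/\ e' \in untouched_at w,
    ~~ touched S (sibling e'), w \notin ends E (sibling e') &
    other_end (E e) w \in ends E (sibling e')].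
Proof.
move=> crit_w e_loose excess0; have [oXS ow oe] := loose_other e_loose.
have [e' [e'K we' ose' ut ut_sib]] := critical_bridge crit_w oXS ow excess0 e_loose oe.
exists e'; split=> //; first by rewrite inE e'K we'.
have /setIdP[/looseP[eK _ t_sib] we] := e_loose; apply/negP => wse'.
rewrite eq_sym in ow.
have ee' : e = sibling e' by apply: edge_eq ow _ oe _ ose'.
by move: t_sib; rewrite ee' siblingK (negbTE ut).
Qed.

(* If no loose edge at [w] led to a vertex of positive excess, two of them would
   form a rainbow triangle with an edge joining their other ends. *)
Lemma critical_loose_excess w : critical w ->
  exists2 e, e \in loose_at w & 0 < excess (other_end (E e) w).
Proof.
move=> crit_w.
have [/exists_inP //|/exists_inPn no_excess] :=
  boolP [exists e in loose_at w, 0 < excess (other_end (E e) w)].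
exfalso; have excess0 e : e \in loose_at w -> excess (other_end (E e) w) = 0.
  by move/no_excess; rewrite lt0n negbK => /eqP.
have [e1 e1_loose] := card_gt0P (critical_loose_gt0 crit_w).
have [e' [e'U ut_sib wse' o1]] :=
  critical_bridge_other crit_w e1_loose (excess0 _ e1_loose).
have [two untouchedE] := critical_third_edge crit_w e'U wse' ut_sib.
have /set0Pn [e2 /setD1P[ne12 e2_loose]] : loose_at w :\ e1 != set0.
  by rewrite -card_gt0; have := cardsD1 e1 (loose_at w); rewrite e1_loose two; clear; lia.
have o2 : other_end (E e2) w \in ends E (sibling e').
  have [e'' [e''U ut_sib'' _ o2]] :=
    critical_bridge_other crit_w e2_loose (excess0 _ e2_loose).
  move: e''U; rewrite untouchedE => /setU1P[<- //|/setIdP[/looseP[_ _]]].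
  by rewrite (negbTE ut_sib'').
have [[e1L we1] [e2L we2]] := (setIdP e1_loose, setIdP e2_loose).
have [[e1K _ t1] [e2K _ t2]] := (looseP _ e1L, looseP _ e2L).
have [e'K /andP[_ ut]] := setIdP e'U.
have o12 : other_end (E e1) w != other_end (E e2) w.
  apply: contraNneq ne12 => same; apply/eqP/ends_inj => //.
  by rewrite (ends_other we1) (ends_other we2) same.
have col_ne e : e \in loose -> e.1 != e'.1.
  move/loose_half; apply: contraTneq => ->.
  by rewrite half_edge (negbTE ut) (negbTE ut_sib).
apply: (@no_triangle e1 (sibling e') e2 w (other_end (E e1) w) (other_end (E e2) w)).
- by move=> c; rewrite !inE => /or3P[]/eqP ->.
- rewrite /= !inE negb_or col_ne // [e'.1 == _]eq_sym col_ne // !andbT /=.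
  by apply: contra ne12 => /eqP /(loose_inj e1L e2L) ->.
- exact: ends_other.
- by apply: set2_eq => //; rewrite card_ends.
- by rewrite setUC; apply: ends_other.
Qed.

Lemma excess_vertex : exists2 y, y \in X :\: S & 0 < excess y.
Proof.
have [w wXS links_w] : exists2 w, w \in X :\: S & 0 < num_links S w.
  have [/exists_inP //|/exists_inPn none] :=
    boolP [exists w in X :\: S, 0 < num_links S w].
  have := sum_links SX; rewrite sparse_num_touched big1; first by lia.
  by move=> w /none; rewrite lt0n negbK => /eqP.
have [excess0|] := posnP (excess w); last by exists w.
have crit_w : critical w by rewrite /critical wXS excess0 eqn_leq links_le1 ?links_w.
have [e e_loose excess_o] := critical_loose_excess crit_w.
have [oXS _ _] := loose_other e_loose.
by exists (other_end (E e) w).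
Qed.

Lemma sparse_star : exists v y, [/\ S = [set v], y \in X :\: S, excess y = 1 &
  forall w, w \in X :\: S -> w != y -> excess w = 0].
Proof.
have [y yXS excess_y] := excess_vertex; have := sum_excess; rewrite (big_setD1 y yXS) /=.
have S_gt0 : 0 < #|S| by rewrite -sparse_num_dead.
move=> le; have /cards1P [v Sv] : #|S| == 1 by apply/eqP; lia.
exists v, y; split=> //; first by lia.
move=> w wXS wy; have /eqP : \sum_(w in (X :\: S) :\ y) excess w = 0 by lia.
by rewrite sum_nat_eq0 => /forall_inP /(_ w); rewrite in_setD1 wy wXS => /(_ isT)/eqP.
Qed.

Section Star.
Variables v y : T.
Hypotheses (Sv : S = [set v]) (yXS : y \in X :\: S) (excess_y : excess y = 1)
  (excess_other : forall w, w \in X :\: S -> w != y -> excess w = 0).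

Let vX : v \in X. Proof. by rewrite -sub1set -Sv. Qed.
Let card_S : #|S| = 1. Proof. by rewrite Sv cards1. Qed.

Lemma star_touched e : touched S e = (v \in ends E e).
Proof. by rewrite Sv touched1. Qed.

Lemma star_not_dead c : c \in K -> ~~ dead S c.
Proof.
move=> cK; have : num_dead S = 0 by have := sparse_num_dead; rewrite card_S => -[].
by move/cards0_eq/setP/(_ c); rewrite !inE cK /= => ->.
Qed.

Lemma spoke_sibling e : e.1 \in K -> v \in ends E e -> v \notin ends E (sibling e).
Proof.
by move=> eK ve; have := star_not_dead eK; rewrite dead_edge !star_touched ve.
Qed.

Lemma spoke_inj e e' :
  e.1 \in K -> v \in ends E e -> v \in ends E e' -> e.1 = e'.1 -> e = e'.
Proof.
case: e e' => [c b] [c' b'] /= cK ve ve' ec; subst c'; congr pair.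
apply: contraTeq ve' => nb; have := @spoke_sibling (c, b) cK ve.
by case: b b' nb {ve} => [] [].
Qed.

Definition nbrs := [set w in X :\: S | num_links S w == 1].

Lemma nbrs_neq w : w \in nbrs -> w != v.
Proof. by case/setIdP => /setDP[_]; rewrite Sv inE. Qed.

Lemma nbrs_sub : nbrs \subset X.
Proof. by apply/subsetP => w /setIdP[/setDP[]]. Qed.

Lemma card_nbrs : #|nbrs| = 4.
Proof.
have := sum_links SX; rewrite sparse_num_touched card_S /nbrs card_setId_sum.
rewrite (eq_bigr (fun w => num_links S w == 1 : nat)) => [|w /links_le1]; first by lia.
by case: (num_links S w) => [|[]].
Qed.

Lemma spokeP w : w \in nbrs -> exists2 e, e.1 \in K & ends E e = [set v; w].
Proof.
move=> wN; have /setIdP[_ /eqP links_w] := wN.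
have /num_links_gt0 [e [eK we]] : 0 < num_links S w by rewrite links_w.
rewrite star_touched => ve; exists e => //; apply: set2_eq; rewrite ?card_ends //.
by rewrite eq_sym nbrs_neq.
Qed.

Lemma nbrs_critical w : w \in nbrs :\ y -> critical w.
Proof.
by case/setD1P => wy /setIdP[wXS links_w]; rewrite /critical wXS links_w excess_other.
Qed.

Lemma nbr_joined w : w \in nbrs :\ y -> exists2 e, e \in loose & ends E e = [set w; y].
Proof.
move=> wN; have [e e_loose excess_o] := critical_loose_excess (nbrs_critical wN).
have [oXS _ _] := loose_other e_loose; have /setIdP[eL we] := e_loose.
exists e; rewrite // (ends_other we); congr [set _; _]; apply/eqP/negPn/negP => oy.
by rewrite excess_other in excess_o.
Qed.

Lemma nbrs_y_loose_y : y \in nbrs /\ #|loose_at y| = 3.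
Proof.
have sub : nbrs :\ y \subset [set other_end (E e) y | e in loose_at y].
  apply/subsetP => w wN; have [e eL ewy] := nbr_joined wN; apply/imsetP.
  have ye : y \in ends E e by rewrite ewy set22.
  exists e; first by rewrite inE eL.
  have : w \in ends E e by rewrite ewy set21.
  by rewrite (ends_other ye) !inE; case/setD1P: wN => /negbTE -> _ /eqP.
have le_loose := leq_trans (subset_leq_card sub) (leq_imset_card _ _).
have := card_loose_at_le y; rewrite num_freshE // excess_y => loose_le.
have := cardsD1 y nbrs; rewrite card_nbrs inE yXS /=; have := links_le1 yXS.
by move: loose_le le_loose; case: (num_links S y) => [|[]] //=; clear; lia.
Qed.

Definition star_colours := [set c in K | half_dead S c].

Lemma card_star_colours : #|star_colours| = 4.
Proof. by rewrite -/(num_half_dead S) sparse_num_half card_S. Qed.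

Lemma star_colours_sub : star_colours \subset K.
Proof. by apply/subsetP => c /setIdP[]. Qed.

Lemma spoke_colour e : e.1 \in K -> v \in ends E e -> e.1 \in star_colours.
Proof.
move=> eK ve; rewrite inE eK half_edge !star_touched ve.
by rewrite (negbTE (spoke_sibling eK ve)).
Qed.

Lemma y_colour e : e.1 \in K -> y \in ends E e -> e.1 \in star_colours.
Proof.
move=> eK ye; have [ve|nve] := boolP (v \in ends E e); first exact: spoke_colour.
have [/setIdP[_ /eqP links_y] loose_y] := nbrs_y_loose_y.
have untouched_y : loose_at y = untouched_at y.
  apply: subset_card_eq.
    by apply/subsetP => f /setIdP[/looseP[fK ut _] yf]; rewrite inE fK yf ut.
  have := card_untouched_at y; rewrite links_y loose_y regular; last by case/setDP: yXS.
  by clear; lia.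
have : e \in loose_at y by rewrite untouched_y inE eK ye star_touched nve.
by case/setIdP => eL _; rewrite inE eK loose_half.
Qed.

Definition star_vertices := v |: nbrs.

Lemma star_vertices_sub : star_vertices \subset X.
Proof. by rewrite subUset sub1set vX nbrs_sub. Qed.

Lemma card_star_vertices : #|star_vertices| = 5.
Proof. by rewrite cardsU1 card_nbrs (contraL (@nbrs_neq v)). Qed.

Lemma off_star e w : e.1 \in K :\: star_colours -> w \in ends E e ->
  w \in star_vertices -> w \in nbrs :\ y.
Proof.
move=> /setDP[eK eD] we /setU1P[wv|wN]; first by rewrite spoke_colour // -wv in eD.
by rewrite inE wN andbT inE; apply: contraNneq eD => wy; rewrite y_colour // -wy.
Qed.

Lemma star_diameter : rainbow_diameter_le E star_colours star_vertices 2.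
Proof.
have spoke w : w \in nbrs -> exists e o, [/\ e.1 \in star_colours, v \in ends E e,
    src E (e, o) = v, tgt E (e, o) = w & w != v].
  move=> wN; have [e eK evw] := spokeP wN; have wv := nbrs_neq wN.
  have ve : v \in ends E e by rewrite evw set21.
  have [o [so to]] := step_of_ends evw.
  by exists e, o; rewrite spoke_colour.
move=> a b aQ bQ; have [->|ab] := eqVneq a b; first by exists [::]; rewrite /= eqxx.
case/setU1P: aQ bQ ab => [->|aN] /setU1P[->|bN]; rewrite ?eqxx // => ab.
- have [e [o [eD _ so to _]]] := spoke b bN.
  by exists [:: (e, o)]; rewrite rainbow_edge //= so to !eqxx.
- have [e [o [eD _ so to _]]] := spoke a aN.
  by exists [:: flip (e, o)]; rewrite rainbow_edge //= src_flip tgt_flip so to !eqxx.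
have [e [o [eD ve so to _]]] := spoke a aN; have [f [o' [fD vf sf tf _]]] := spoke b bN.
exists [:: flip (e, o); (f, o')]; split=> //=.
  by rewrite src_flip tgt_flip so to sf tf !eqxx.
rewrite rainbow_cons rainbow_edge // eD inE /= andbT; apply: contraNneq ab => ef.
have e_f := spoke_inj (subsetP star_colours_sub _ eD) ve vf ef; subst f.
have : a \in ends E e by rewrite -to (tgt_ends E (e, o)).
by rewrite (ends_step E (e, o')) sf tf !inE (negbTE (nbrs_neq aN)).
Qed.

Lemma star_no_chord e : e.1 \in K :\: star_colours -> ~~ (ends E e \subset star_vertices).
Proof.
move=> eKD; have /setDP[eK eD] := eKD; apply/negP => /subsetP sub.
have nbr a : a \in ends E e -> a \in nbrs.
  by move=> ae; case/setD1P: (off_star eKD ae (sub a ae)).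
have aN : (E e).1 \in nbrs by rewrite nbr ?set21.
have bN : (E e).2 \in nbrs by rewrite nbr ?set22.
have [[f fK fva] [g gK gvb]] := (spokeP aN, spokeP bN).
have [vf vg] : v \in ends E f /\ v \in ends E g by rewrite fva gvb !set21.
have [fD gD] := (spoke_colour fK vf, spoke_colour gK vg).
apply: (no_triangle (e1 := f) (e2 := e) (e3 := g) _ _ fva erefl).
- by move=> c; rewrite !inE => /or3P[]/eqP ->.
- rewrite /= !inE negb_or andbT; apply/andP; split; first (apply/andP; split).
  + by apply: contraNneq eD => <-.
  + apply/eqP => fg; have := no_loop eK; rewrite (_ : (E e).1 = (E e).2) ?eqxx //.
    have : (E e).1 \in ends E f by rewrite fva set22.
    rewrite (spoke_inj fK vf vg fg) gvb !inE => /orP[/eqP av|/eqP //].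
    by have := nbrs_neq aN; rewrite av eqxx.
  + by apply: contraNneq eD => ->.
- by rewrite gvb setUC.
Qed.

Lemma loose_off_y t e : t \in nbrs :\ y -> e.1 \in K :\: star_colours ->
  t \in ends E e -> t \notin ends E (sibling e) ->
  exists f, [/\ f \in loose, t \in ends E f & y \notin ends E f].
Proof.
move=> tN /setDP[eK eD] te nts.
have untouched e' : e'.1 = e.1 -> ~~ touched S e'.
  move=> ee'; rewrite star_touched; apply: contra eD => ve'.
  by rewrite -ee' spoke_colour ?ee'.
have eU : e \in untouched_at t by rewrite inE eK te untouched.
have [|two _] := critical_third_edge (nbrs_critical tN) eU nts; first exact: untouched.
have [g gL gty] := nbr_joined tN; have [tg yg] : t \in ends E g /\ y \in ends E g.
  by rewrite gty set21 set22.
have /set0Pn [f /setD1P[fg /setIdP[fL tf]]] : loose_at t :\ g != set0.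
  rewrite -card_gt0; have := cardsD1 g (loose_at t).
  by rewrite two inE gL tg; clear; lia.
exists f; split=> //; apply: contra fg => yf; apply/eqP.
have [[fK _ _] [gK _ _]] := (looseP _ fL, looseP _ gL).
by case/setD1P: tN => ty _; apply: edge_eq ty tf yf tg yg.
Qed.

Lemma loose_off_y_uniq f f' : f \in loose -> y \notin ends E f ->
  f' \in loose -> y \notin ends E f' -> f = f'.
Proof.
move=> fL yf f'L yf'; have /cards1P [g off_y] : #|loose :\: loose_at y| == 1.
  have sub : loose_at y \subset loose by apply/subsetP => e /setIdP[].
  have [_ loose_y] := nbrs_y_loose_y.
  by rewrite cardsD (setIidPr sub) card_loose sparse_num_half card_S loose_y.
have off e : e \in loose -> y \notin ends E e -> e = g.
  by move=> eL ye; apply/set1P; rewrite -off_y 2!inE eL (negbTE ye).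
by rewrite (off f) // (off f').
Qed.

Lemma star_cherry_loose s s' : col s \in K :\: star_colours -> s'.1 = sibling s.1 ->
  src E s' = src E s -> tgt E s != tgt E s' -> tgt E s \in star_vertices ->
  tgt E s \in nbrs :\ y /\
  exists f, [/\ f \in loose, tgt E s \in ends E f & y \notin ends E f].
Proof.
move=> sKD ss' src_eq tgt_ne tQ; have tN := off_star sKD (tgt_ends E s) tQ.
split=> //; apply: (loose_off_y tN sKD (tgt_ends E s)).
rewrite -ss' ends_step src_eq !inE negb_or tgt_ne andbT eq_sym.
have := @card_ends s.1; rewrite ends_step cards2 => card_s.
by have /card_s : s.1.1 \in K by [case/setDP: sKD]; case: (_ != _).
Qed.

(* The two outer vertices of such a colour would form a rainbow triangle with [y]. *)
Lemma star_no_new_parallel c : c \in K :\: star_colours ->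
  ~~ parallel (contracted E star_vertices v) c.
Proof.
move=> cKD; have /setDP[cK _] := cKD; apply/negP => pc.
have [s1 [s2 [e1 e2 src12 tgt12 [_ t1Q t2Q]]]] := parallel_contracted (setU11 v nbrs) pc
  (no_parallel cK) (fun b => @star_no_chord (c, b) cKD).
have [s1KD s2KD] : col s1 \in K :\: star_colours /\ col s2 \in K :\: star_colours.
  by rewrite /col e1 e2.
have sib12 : s2.1 = sibling s1.1 by rewrite e1 e2.
have sib21 : s1.1 = sibling s2.1 by rewrite e1 e2.
have [t1N [f1 [f1L t1f1 yf1]]] := star_cherry_loose s1KD sib12 (esym src12) tgt12 t1Q.
rewrite eq_sym in tgt12.
have [t2N [f2 [f2L t2f2 yf2]]] := star_cherry_loose s2KD sib21 src12 tgt12 t2Q.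
have f12 := loose_off_y_uniq f1L yf1 f2L yf2; subst f2.
set t1 := tgt E s1 in tgt12 t1N t1f1; set t2 := tgt E s2 in tgt12 t2N t2f2.
have [[g1 g1L g1y] [g2 g2L g2y]] := (nbr_joined t1N, nbr_joined t2N).
have [[[g1K _ _] [g2K _ _]] [f1K _ _]] := (looseP _ g1L, looseP _ g2L, looseP _ f1L).
have col_ne g : g \in loose -> y \in ends E g -> g.1 != f1.1.
  by move=> gL yg; apply: contraNneq yf1 => /(loose_inj gL f1L) <-.
apply: (@no_triangle g1 f1 g2 y t1 t2).
- by move=> d; rewrite !inE => /or3P[]/eqP ->.
- rewrite /= !inE negb_or andbT [f1.1 == _]eq_sym !col_ne ?g1y ?g2y ?set22 // andbT.
  apply: contra tgt12 => /eqP /(loose_inj g1L g2L) g12.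
  have : t1 \in ends E g2 by rewrite -g12 g1y set21.
  by rewrite g2y !inE eq_sym; case/setD1P: t1N => /negbTE -> _; rewrite orbF.
- by rewrite g1y setUC.
- by apply: set2_eq => //; rewrite ?card_ends // eq_sym.
- by rewrite g2y.
Qed.

Lemma star_absurd : False.
Proof.
pose D := star_colours; pose Q := star_vertices.
have vQ : v \in Q by apply: setU11.
have m4 := m_gt4; have D4 := card_star_colours.
have card_X' : #|v |: (X :\: Q)| = m - 4.
  have := card_contracted vQ star_vertices_sub; rewrite card_star_vertices card_X.
  by move: m4; clear; lia.
have card_K' : #|K :\: D| = m - 4.
  by rewrite cardsD (setIidPr star_colours_sub) card_K D4.
have in_X' : edges_in (contracted E Q v) (K :\: D) (v |: (X :\: Q)).
  apply: edges_in_sub (subsetDl _ _) _; exact: contracted_in vQ star_vertices_sub EX.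
have [lt0 ltm] : 0 < m - 4 /\ m - 4 < m by move: m4; clear; lia.
have := bound_lt ltm card_X' card_K' lt0 in_X'.
rewrite num_parallel0 => [|c]; last exact: star_no_new_parallel.
rewrite addn0 => /(has_circuit_contract vQ star_colours_sub star_diameter).
move=> short; apply: no_circuit; apply: has_circuit_mono short => //.
by move: m4; clear; lia.
Qed.

End Star.

Lemma maximal_sparse_absurd : False.
Proof.
have [v [y [Sv yXS excess_y excess_other]]] := sparse_star.
exact: star_absurd Sv yXS excess_y excess_other.
Qed.

End MaximalSparse.

Lemma even_absurd : False.
Proof.
have [/forall_inP centres|/forall_inPn [v vX]] :=
    boolP [forall v in X, [exists c in K, cherry v c]].
  have [c0 c0K] : exists c, c \in K by apply/card_gt0P; rewrite card_K.
  pose ctr v := odflt c0 [pick c in K | cherry v c].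
  apply: (@all_centres_absurd ctr) => v /centres /exists_inP [c cK cherry_v].
  rewrite /ctr; case: pickP => [c' /andP[] //|/(_ c)]; rewrite /= cK.
  by rewrite cherry_v.
move=> /exists_inPn no_cherry.
have sparse_v : sparse [set v].
  rewrite /sparse sub1set vX cards1 num_touched1 regular //= ltnS leqn0 cards_eq0.
  apply/eqP/setP => c; rewrite !inE; apply/negP => /andP[/no_cherry/negP cK].
  by rewrite /dead !touched1.
case: (arg_maxnP (fun S : {set T} => #|S|) sparse_v) => S.
exact: maximal_sparse_absurd.
Qed.

End EvenCase.

Theorem girth_bound_holds (T C : finType) m : girth_bound T C m.
Proof.
have [n] := ubnP m; elim: n m => // n IHn m lt_m E K X card_X card_K m_gt0 EX.
have bound_lt m' : m' < m -> girth_bound T C m'.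
  by move=> lt; apply: IHn; apply: leq_trans lt _.
have [/exists_inP [c cK pc]|/exists_inPn no_parallel] :=
    boolP [exists c in K, parallel E c].
  exact: girth_bound_parallel bound_lt card_X card_K EX cK pc.
rewrite num_parallel0 // addn0; have [odd_m|even_m] := boolP (odd m).
  exact: girth_bound_odd card_X card_K EX no_parallel.
apply: contrapT => no_circuit.
exact: even_absurd bound_lt even_m m_gt0 card_X card_K EX no_parallel no_circuit.
Qed.

(** * Upper bounds for the rainbow girth *)

Lemma enum_card2 (A : finType) (B : {set A}) : #|B| = 2 ->
  exists x y, [/\ enum B = [:: x; y], x != y & B = [set x; y]].
Proof.
move=> B2; have := enum_uniq B; have := mem_enum B; move: B2; rewrite cardE.
case: (enum B) => [|x [|y []]] //= _ memB; rewrite inE andbT => xy.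
by exists x, y; split=> //; apply/setP => z; rewrite -memB !inE.
Qed.

Lemma edge_adj (V : finType) (G : sgraph V) x y : ([set x; y] \in edges G) = adj G x y.
Proof.
apply/imsetP/idP => [[[x' y']]|xy]; last by exists (x, y); rewrite ?inE.
by rewrite inE /= => xy' /set2_inj[] [-> ->] //; rewrite adj_sym.
Qed.

Lemma edgesP (V : finType) (G : sgraph V) e :
  e \in edges G -> exists x y, [/\ e = [set x; y], adj G x y & x != y].
Proof.
case/imsetP => -[x y]; rewrite inE /= => xy ->; exists x, y; split=> //.
by apply: contraTneq xy => ->; rewrite adj_irrefl.
Qed.

Section ClassGraph.
Variables (V : finType) (C : eqType) (G : sgraph V) (c : {set V} -> C) (x0 : V).
Hypothesis size2 : classes_of_size2 G c.
Implicit Types (k : {set {set V}}) (e : {set {set V}} * bool).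

Definition classes : {set {set {set V}}} := preim_partition c (edges G).

Lemma classP k : k \in classes -> exists2 e, e \in edges G & k = colour_class G c (c e).
Proof.
by case/imsetP => e eG ->; exists e => //; apply/setP => e'; rewrite !inE eq_sym.
Qed.

Lemma card_classes t : #|edges G| = 2 * t -> #|classes| = t.
Proof.
have size_class : {in classes, forall k, #|k| = 2}.
  by move=> k /classP [e eG ->]; apply: size2.
rewrite (card_uniform_partition size_class (preim_partitionP c (edges G))) mulnC.
by move/eqP; rewrite eqn_mul2l => /eqP.
Qed.

Definition class_edge e : {set V} := nth set0 (enum e.1) e.2.

Definition class_graph e : V * V :=
  (nth x0 (enum (class_edge e)) 0, nth x0 (enum (class_edge e)) 1).

Lemma class_edgeP k : k \in classes -> exists a,
  [/\ forall b, class_edge (k, b) \in edges G, forall b, c (class_edge (k, b)) = a,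
      k = colour_class G c a & class_edge (k, false) != class_edge (k, true)].
Proof.
case/classP => e eG kE; exists (c e).
have [|e1 [e2 [enum_k ne12 k12]]] := @enum_card2 _ k; first by rewrite kE size2.
have class_edge_in b : class_edge (k, b) \in colour_class G c (c e).
  by rewrite -kE k12 /class_edge -k12 enum_k; case: b; rewrite k12 !inE eqxx ?orbT.
split=> // [b|b|]; last by rewrite /class_edge enum_k.
  by case/setIdP: (class_edge_in b).
by case/setIdP: (class_edge_in b) => _ /eqP.
Qed.

Lemma class_edge_colour k k' b b' : k \in classes -> k' \in classes ->
  c (class_edge (k, b)) = c (class_edge (k', b')) -> k = k'.
Proof. by case/class_edgeP => a [_ -> -> _] /class_edgeP [a' [_ -> -> _]] ->. Qed.

Lemma class_graph_ends e : e.1 \in classes -> ends class_graph e = class_edge e.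
Proof.
case: e => k b /class_edgeP [a [/(_ b) /edgesP [x [y [exy _ xy]]] _ _ _]].
have [|x' [y' [enum_e _ ->]]] := @enum_card2 _ (class_edge (k, b)).
  by rewrite exy cards2 xy.
by rewrite /ends /class_graph enum_e.
Qed.

Lemma class_graph_adj s :
  col s \in classes -> adj G (src class_graph s) (tgt class_graph s).
Proof.
move=> sK; rewrite -edge_adj -ends_step class_graph_ends //.
by case: s sK => -[k b] o /class_edgeP [a [edge_in _ _ _]]; apply: edge_in.
Qed.

Lemma class_graph_not_parallel k : k \in classes -> ~~ parallel class_graph k.
Proof.
by move=> kK; rewrite /parallel !class_graph_ends //; case/class_edgeP: kK => a [].
Qed.

Lemma circuit_size_ge3 l : circuit class_graph classes l -> 2 < size l.
Proof.
case/and3P; case: l => // s [|s' [|//]] _ /=.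
  rewrite andbT => /eqP ss; rewrite rainbow_cons => /andP[/class_graph_adj].
  by rewrite ss adj_irrefl.
rewrite andbT /link => /andP[/eqP ts /eqP ts']; rewrite !rainbow_cons /= !inE.
case/and4P => sK /eqP ne s'K _; case: ne.
have same : ends class_graph s.1 = ends class_graph s'.1.
  by rewrite !ends_step ts ts' setUC.
rewrite !class_graph_ends // in same.
apply: (@class_edge_colour _ _ s.1.2 s'.1.2 sK s'K).
by rewrite /col -!surjective_pairing same.
Qed.

Lemma rainbow_cycle_of_circuit l : circuit class_graph classes l ->
  uniq (map (src class_graph) l) -> rainbow_cycle G c (map (src class_graph) l).
Proof.
move=> cl u; have /and3P[_ cyc r] := cl; have in_classes := rainbow_mem r.
apply/and3P; split; first by rewrite size_map circuit_size_ge3.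
  rewrite /ucycleb u andbT cycle_map; apply: sub_in_cycle cyc; last exact: allss.
  by move=> s s' sl _ /eqP tgt_s; rewrite /= -tgt_s; apply/class_graph_adj/in_classes.
pose first_edge_colour k := c (class_edge (k, false)).
rewrite -map_comp (_ : map _ l = map first_edge_colour (map (@col _) l)); last first.
  rewrite -map_comp; apply/eq_in_map => s sl /=; have sK := in_classes s sl.
  have /eqP next_s := next_cycle cyc sl.
  rewrite next_map_uniq // -next_s -ends_step class_graph_ends //.
  case: s sK {sl next_s} => -[k b] o /class_edgeP [a [_ col_k _ _]].
  by rewrite /first_edge_colour !col_k.
rewrite map_inj_in_uniq; first by case/andP: r.
move=> k k' /mapP [s /in_classes sK ->] /mapP [s' /in_classes s'K ->].
exact: class_edge_colour.
Qed.

Lemma has_rainbow_cycle_of_circuit B : has_circuit class_graph classes B ->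
  exists2 j, has_rainbow_cycle G c j & j.*2 <= B.
Proof.
case=> l /simple_circuit [l' [cl' u /size_subseq le_l']] le_B; exists (size l').
  have size_p : size (map (src class_graph) l') == size l' by rewrite size_map.
  by apply/existsP; exists (Tuple size_p); apply: rainbow_cycle_of_circuit.
by apply: leq_trans le_B; rewrite leq_double.
Qed.

Lemma exists_rainbow_cycle_uphalf : #|edges G| = 2 * #|V| ->
  exists2 j, has_rainbow_cycle G c j & j <= uphalf #|V|.
Proof.
move=> /card_classes card_K; have V_gt0 : 0 < #|V| by apply/card_gt0P; exists x0.
have in_V : edges_in class_graph classes [set: V] by move=> e _; apply: subsetT.
have := girth_bound_holds (cardsT V) card_K V_gt0 in_V.
rewrite (num_parallel0 class_graph_not_parallel) addn0.
by case/has_rainbow_cycle_of_circuit => j cj le; exists j => //; lia.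
Qed.

Definition common_vertex v k :=
  (v \in class_edge (k, false)) && (v \in class_edge (k, true)).

Lemma common_vertex_uniq v w k :
  k \in classes -> common_vertex v k -> common_vertex w k -> v = w.
Proof.
move=> kK /andP[vf vt] /andP[wf wt]; apply/eqP; apply: contraTT isT => vw.
have [a [_ _ _ /eqP]] := class_edgeP kK; case.
have edge2 b : #|class_edge (k, b)| <= 2.
  by rewrite -(@class_graph_ends (k, b)) // cards2; case: (_ != _).
by rewrite (set2_eq (edge2 false) vf wf vw) (set2_eq (edge2 true) vt wt vw).
Qed.

Lemma exists_not_common : #|classes| < #|V| ->
  exists v, {in classes, forall k, ~~ common_vertex v k}.
Proof.
move=> lt; pose common k := odflt x0 [pick v | common_vertex v k].
have /subsetPn [v _ v_common] : ~~ ([set: V] \subset common @: classes).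
  apply: contraL lt => /subset_leq_card; rewrite cardsT -leqNgt => le.
  exact: leq_trans le (leq_imset_card _ _).
exists v => k kK; apply: contra v_common => vk; apply/imsetP; exists k => //.
rewrite /common; case: pickP => [w wk|/(_ v)]; last by rewrite vk.
exact: common_vertex_uniq vk wk.
Qed.

Lemma exists_rainbow_cycle_pred : 1 < #|V| -> #|edges G| = 2 * (#|V| - 1) ->
  exists2 j, has_rainbow_cycle G c j & j <= #|V| - 1.
Proof.
move=> V_gt1 /card_classes card_K.
have [v not_common] : exists v, {in classes, forall k, ~~ common_vertex v k}.
  by apply: exists_not_common; rewrite card_K; lia.
pose b e := v \in class_edge (e.1, false).
pose E := fun e => class_graph (e.1, b e).
have in_X : edges_in E classes [set~ v].
  move=> e eK; rewrite -[ends E e]/(ends class_graph (e.1, b e)).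
  rewrite class_graph_ends // subsetC sub1set in_setC; have := not_common e.1 eK.
  rewrite /common_vertex /b.
  by case vf: (v \in class_edge (e.1, false)); rewrite ?vf.
have card_X : #|[set~ v]| = #|V| - 1 by rewrite cardsC1 subn1.
have V1 : 0 < #|V| - 1 by rewrite subn_gt0.
have /has_circuit_select := girth_bound_holds card_X card_K V1 in_X.
case/has_rainbow_cycle_of_circuit => j cj le; exists j => //.
have := num_parallel_le E classes; rewrite card_K; move: le.
by move: (num_parallel _ _); clear; lia.
Qed.

End ClassGraph.

Section RainbowGirth.
Variables (V : finType) (C : eqType) (G : sgraph V) (c : {set V} -> C).

Lemma rainbow_girth_le B :
  (exists2 j, has_rainbow_cycle G c j & j <= B) -> enat_le (rainbow_girth G c) (Some B).
Proof.
case=> j cj le; rewrite /rainbow_girth; case: pselect => [ex|[]]; last by exists j.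
by case: ex_minnP => k _ /(_ j cj) /leq_trans; apply.
Qed.

Lemma rainbow_girth_eq B : enat_le (rainbow_girth G c) (Some B) ->
  (forall j, has_rainbow_cycle G c j -> B <= j) -> rainbow_girth G c = Some B.
Proof.
rewrite /rainbow_girth; case: pselect => // ex; case: ex_minnP => k ck _ /= le ge.
by congr Some; apply/eqP; rewrite eqn_leq le ge.
Qed.

Lemma rainbow_girth_None :
  (forall j, ~~ has_rainbow_cycle G c j) -> rainbow_girth G c = None.
Proof.
move=> none; rewrite /rainbow_girth; case: pselect => // -[j cj].
by have := none j; rewrite cj.
Qed.

Lemma rainbow_girth_le_uphalf : 0 < #|V| -> classes_of_size2 G c ->
  #|edges G| = 2 * #|V| -> enat_le (rainbow_girth G c) (Some (uphalf #|V|)).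
Proof.
case/card_gt0P => x0 _ size2 card_E.
exact: rainbow_girth_le (exists_rainbow_cycle_uphalf x0 size2 card_E).
Qed.

Lemma rainbow_girth_le_pred : 1 < #|V| -> classes_of_size2 G c ->
  #|edges G| = 2 * (#|V| - 1) -> enat_le (rainbow_girth G c) (Some (#|V| - 1)).
Proof.
move=> V_gt1 size2 card_E; have [x0 _] := card_gt0P (ltnW V_gt1).
exact: rainbow_girth_le (exists_rainbow_cycle_pred x0 size2 V_gt1 card_E).
Qed.

End RainbowGirth.

(** * Extremal examples *)

Section ArcGraph.
Variables (V : finType) (D : {set V}) (out : bool -> V -> V).
Hypothesis out_neq : {in D, forall x, out false x != out true x}.

Definition arc : rel V := fun x y => (x \in D) && [exists b, y == out b x].

Hypothesis arc_asym : forall x y, arc x y -> ~~ arc y x.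

Lemma arcP x y : reflect (exists2 b, x \in D & y = out b x) (arc x y).
Proof.
apply: (iffP andP) => [[xD /existsP [b /eqP ->]]|[b xD ->]]; first by exists b.
by split=> //; apply/existsP; exists b.
Qed.

Lemma arc_sym : symmetric (fun x y => arc x y || arc y x).
Proof. by move=> x y; rewrite orbC. Qed.

Lemma arc_irrefl : irreflexive (fun x y => arc x y || arc y x).
Proof. by move=> x; rewrite orbb; apply/negP => xx; have := arc_asym xx; rewrite xx. Qed.

Definition arc_graph := SGraph arc_sym arc_irrefl.

Definition tail (e : {set V}) : option V :=
  [pick x | [exists y, arc x y && (e == [set x; y])]].

Lemma tail_arc x y : arc x y -> tail [set x; y] = Some x.
Proof.
move=> xy; rewrite /tail.
case: pickP => [x' /existsP [y' /andP[xy' /eqP]]|/(_ x)/existsP[]].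
  by case/set2_inj => [[-> _] //|[ex ey]]; have := arc_asym xy; rewrite ex ey xy'.
by exists y; rewrite xy eqxx.
Qed.

Lemma arc_edge x b : x \in D -> [set x; out b x] \in edges arc_graph.
Proof. by move=> xD; rewrite edge_adj /=; apply/orP; left; apply/arcP; exists b. Qed.

Lemma tail_out x b : x \in D -> tail [set x; out b x] = Some x.
Proof. by move=> xD; apply/tail_arc/arcP; exists b. Qed.

Lemma arc_edgesP e : e \in edges arc_graph -> exists x b, x \in D /\ e = [set x; out b x].
Proof.
case/imsetP => -[x y]; rewrite inE /= => /orP[] /arcP [b xD ->] ->.
  by exists x, b.
by exists y, b; rewrite setUC.
Qed.

Lemma arc_edge_inj :
  {in setX D [set: bool] &, injective (fun p => [set p.1; out p.2 p.1])}.
Proof.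
move=> [x b] [x' b'] /setXP[/= xD _] /setXP[/= x'D _] same.
have [xx'] : Some x = Some x' by rewrite -(tail_out b xD) -(tail_out b' x'D) same.
subst x'; congr pair; have : out b x = out b' x.
  by case: (set2_inj same) => [[]//|[<- ->]].
by have := out_neq xD; case: b b' {same} => [] [] // /eqP ne eq_out; case: ne.
Qed.

Lemma card_arc_edges : #|edges arc_graph| = 2 * #|D|.
Proof.
rewrite -card_bool -cardsT mulnC -cardsX -(card_in_imset arc_edge_inj).
apply: eq_card => e; apply/idP/imsetP => [/arc_edgesP [x [b [xD ->]]]|[[x b]]].
  by exists (x, b); rewrite // !inE xD.
by rewrite !inE andbT /= => xD ->; apply: arc_edge.
Qed.

Lemma arc_colouring_size2 : classes_of_size2 arc_graph tail.
Proof.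
move=> _ /arc_edgesP [x [b [xD ->]]]; rewrite tail_out //.
have -> : colour_class arc_graph tail (Some x) = [set [set x; out b x] | b : bool].
  apply/setP => e; rewrite inE; apply/andP/imsetP => [[]|[b' _ ->]].
    case/arc_edgesP => y [b' [yD ->]]; rewrite tail_out // => /eqP[<-].
    by exists b'.
  by rewrite arc_edge // tail_out.
rewrite card_imset ?card_bool // => b1 b2 same.
by have := @arc_edge_inj (x, b1) (x, b2); rewrite !inE xD => /(_ isT isT same) [].
Qed.

(* The tails of the arcs of a rainbow cycle are distinct vertices of the cycle,
   hence all of its vertices. *)
Lemma rainbow_cycle_out p : rainbow_cycle arc_graph tail p ->
  {in p, forall x, x \in D /\ exists b, out b x \in p}.
Proof.
case/and3P => _ /andP[cyc_p uniq_p] uniq_tails.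
pose tail_next x := tail [set x; next p x].
have tail_nextP x : x \in p ->
    exists y b, [/\ tail_next x = Some y, y \in D, y \in p & out b y \in p].
  move=> xp; have nextp : next p x \in p by rewrite mem_next.
  rewrite /tail_next; case/orP: (next_cycle cyc_p xp) => /arcP [b xD eout].
    by exists x, b; rewrite eout tail_out // -eout.
  exists (next p x), b; split; rewrite -?eout //.
  by rewrite setUC [X in [set _; X]]eout tail_out.
have sub : {subset map tail_next p <= map Some p}.
  by move=> _ /mapP [x xp ->]; have [y [b [-> _ yp _]]] := tail_nextP x xp; apply: map_f.
have [|_ tails_p] := uniq_min_size (s1 := map tail_next p) uniq_tails sub.
  by rewrite !size_map.
move=> x xp; have : Some x \in map tail_next p by rewrite tails_p map_f.
case/mapP => z zp; have [y [b [-> yD _ outp]]] := tail_nextP z zp => -[->].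
by split=> //; exists b.
Qed.

End ArcGraph.

Lemma rainbow_cycle_nonempty (V : finType) (C : eqType) (G : sgraph V)
    (c : {set V} -> C) p :
  rainbow_cycle G c p -> exists x, x \in p.
Proof. by case/and3P; case: p => // x p _ _ _; exists x; apply: mem_head. Qed.

Lemma infinite_girth_example n t : 3 <= n -> t <= n - 2 -> rainbow_girth_value n t None.
Proof.
move=> n3 tn; have [|D0 _ card_D0] := @ex_subset_card 'I_(n - 2) [set: 'I_(n - 2)] t.
  by rewrite cardsT card_ord.
pose V : finType := (bool + 'I_(n - 2))%type.
pose D : {set V} := [set inr x | x in D0]; pose out (b : bool) (_ : V) : V := inl b.
have inlD b : inl b \notin D by apply/negP => /imsetP [].
have asym x y : arc D out x y -> ~~ arc D out y x.
  by case/arcP => b _ ->; rewrite /arc (negbTE (inlD b)).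
exists V, (option V), (arc_graph asym), (tail D out); split.
- by rewrite card_sum card_bool card_ord; lia.
- by rewrite card_arc_edges ?card_imset ?card_D0 //; apply: inr_inj.
- exact: arc_colouring_size2.
apply: rainbow_girth_None => j; apply/existsP => -[p cp].
have [x xp] := rainbow_cycle_nonempty cp; have outP := rainbow_cycle_out cp.
by have [_ [b /outP []]] := outP x xp; rewrite (negbTE (inlD b)).
Qed.

Lemma iter_ordS n (i : 'I_n) k : iter k (@ordS n) i = (i + k) %% n :> nat.
Proof.
elim: k => [|k IH]; first by rewrite addn0 modn_small.
by rewrite iterS /= IH addnS -addn1 modnDml addn1.
Qed.

Lemma iter_ordS_onto n (i j : 'I_n) : exists k, iter k (@ordS n) i = j.
Proof.
exists (n - i + j); apply: val_inj; rewrite /= iter_ordS addnA subnKC 1?ltnW //.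
by rewrite modnDl modn_small.
Qed.

Lemma iter_ordS_neq n (i : 'I_n) k : 0 < k < n -> iter k (@ordS n) i != i.
Proof.
case/andP=> k_gt0 k_lt_n; rewrite -val_eqE /= iter_ordS.
rewrite -[X in _ != X](modn_small (ltn_ord i)).
by rewrite -[X in _ != X %% _]addn0 eqn_modDl mod0n modn_small // -lt0n.
Qed.

Lemma uphalf_le_card n (P : {set 'I_n}) : P != set0 ->
  {in P, forall x, ordS x \in P \/ ordS (ordS x) \in P} -> uphalf n <= #|P|.
Proof.
case/set0Pn => z zP nextP.
have one_of_two y : (y \in P) || (ordS y \in P).
  apply: contraT; rewrite negb_or => gap.
  have missed k x : iter k (@ordS n) x = y -> (x \notin P) && (ordS x \notin P).
    elim: k x => [|k IH] x; first by move=> /= ->.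
    rewrite iterSr => /IH /andP[nSx nSSx]; rewrite nSx andbT.
    by apply/negP => /nextP [xP|xP]; rewrite xP in nSx nSSx.
  by have [k /missed] := iter_ordS_onto z y; rewrite zP.
have cover : P :|: (@ordS n) @^-1: P = [set: 'I_n].
  by apply/setP => x; rewrite !inE one_of_two.
have : n <= #|P| + #|P|.
  rewrite -{1}(card_ord n) -cardsT -cover (leq_trans (leq_card_setU _ _)) //.
  by rewrite card_preimset //; apply: ordS_inj.
by clear; lia.
Qed.

Definition girth_ge_example n t B :=
  exists (V : finType) (C : eqType) (G : sgraph V) (c : {set V} -> C),
    [/\ #|V| = n, #|edges G| = 2 * t, classes_of_size2 G c
      & forall j, has_rainbow_cycle G c j -> B <= j].

Lemma wheel_example n : 4 <= n -> girth_ge_example n (n - 1) (n - 1).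
Proof.
move=> n4; pose V : finType := option 'I_(n - 1); pose D : {set V} := [set~ None].
pose out (b : bool) (x : V) : V := if b then None else omap (@ordS _) x.
have out_neq : {in D, forall x, out false x != out true x} by case=> // /[!inE].
have asym x y : arc D out x y -> ~~ arc D out y x.
  case/arcP => -[]; rewrite !inE; first by move=> _ ->; rewrite /arc !inE.
  case: x => // i _ -> /=; apply/arcP => -[[] // _ []] /esym/eqP.
  by apply/negP; apply: (@iter_ordS_neq _ i 2); lia.
exists V, (option V), (arc_graph asym), (tail D out); split.
- by rewrite card_option card_ord; lia.
- by rewrite card_arc_edges // cardsC1 card_option card_ord.
- exact: arc_colouring_size2.
move=> j /existsP [p cp]; have outP := rainbow_cycle_out cp.
have ordS_p i : Some i \in (p : seq V) -> Some (ordS i) \in (p : seq V).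
  by case/outP => _ [[] //] /outP [] /[!inE].
have [i ip] : exists i, Some i \in (p : seq V).
  have [x xp] := rainbow_cycle_nonempty cp; have [xD _] := outP x xp.
  by case: x xD xp => [i _ ip|/[!inE]//]; exists i.
have all_p k : Some k \in (p : seq V).
  by have [m <-] := iter_ordS_onto i k; elim: m => [|m] //=; apply: ordS_p.
rewrite -(size_tuple p) -[n - 1]card_ord cardE -(size_map Some); apply: uniq_leq_size.
  by rewrite map_inj_uniq ?enum_uniq //; apply: Some_inj.
by move=> _ /mapP [k _ ->].
Qed.

Lemma square_cycle_example n : 5 <= n -> girth_ge_example n n (uphalf n).
Proof.
move=> n5; pose V : finType := 'I_n.
pose out (b : bool) (x : V) : V := if b then ordS (ordS x) else ordS x.
have iter_neq (x : V) k : 0 < k < 5 -> iter k (@ordS n) x != x.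
  by move=> /andP[k_gt0 k_lt5]; rewrite iter_ordS_neq // k_gt0 (leq_trans k_lt5).
have out_neq : {in [set: V], forall x, out false x != out true x}.
  by move=> x _; rewrite eq_sym (iter_neq _ 1).
have asym x y : arc [set: V] out x y -> ~~ arc [set: V] out y x.
  case/arcP => b _ ->; apply/arcP => -[b' _] /esym/eqP; apply/negP.
  by case: b b' => [] []; [apply: (iter_neq x 4) | apply: (iter_neq x 3)
    | apply: (iter_neq x 3) | apply: (iter_neq x 2)].
exists V, (option V), (arc_graph asym), (tail [set: V] out); split.
- by rewrite card_ord.
- by rewrite card_arc_edges // cardsT card_ord.
- exact: arc_colouring_size2.
move=> j /existsP [p cp]; have outP := rainbow_cycle_out cp.
have card_P : #|[set x in (p : seq V)]| <= j.
  by rewrite cardsE; have := card_size (tval p); rewrite size_tuple.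
apply: leq_trans card_P; apply: uphalf_le_card => [|x].
  by have [z zp] := rainbow_cycle_nonempty cp; apply/set0Pn; exists z; rewrite inE.
by rewrite inE => /outP [_ [[] xp]]; rewrite !inE; [right | left].
Qed.

Lemma is_f_Some n t B :
  (forall (V : finType) (C : eqType) (G : sgraph V) (c : {set V} -> C), #|V| = n ->
    #|edges G| = 2 * t -> classes_of_size2 G c -> enat_le (rainbow_girth G c) (Some B)) ->
  girth_ge_example n t B -> is_f n t (Some B).
Proof.
move=> upper [V [C [G [c [card_V card_E size2 lower]]]]]; split.
  by exists V, C, G, c; split=> //; apply: rainbow_girth_eq => //; apply: upper.
by move=> _ [V' [C' [G' [c' [card_V' card_E' size2' <-]]]]]; apply: upper.
Qed.

Theorem theorem3p1 (n t : nat) (hn : 3 <= n) (ht : t <= n) :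
  [/\ t <= n - 2 -> is_f n t None,
      t = n - 1 -> 2 * t <= 'C(n, 2) -> is_f n t (Some (n - 1))
    & t = n -> 2 * t <= 'C(n, 2) -> is_f n t (Some (uphalf n))].
Proof.
split=> [tn|-> bin|-> bin].
- by split; [apply: infinite_girth_example | case].
- apply: is_f_Some; last by apply: wheel_example; case: n hn bin {ht} => [|[|[|[|n]]]].
  move=> V C G c card_V; rewrite -card_V => card_E size2.
  by apply: rainbow_girth_le_pred => //; rewrite card_V ltnW.
- apply: is_f_Some; last first.
    by apply: square_cycle_example; case: n hn bin {ht} => [|[|[|[|[|n]]]]].
  move=> V C G c card_V; rewrite -card_V => card_E size2.
  by apply: rainbow_girth_le_uphalf => //; rewrite card_V (leq_trans _ hn).
Qed.
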